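(* Let $I\subset\mathbb{R}$ be a closed interval and let $\Phi:I\to\mathbb{R}$ be a smooth convex function such that the function $$\Psi(u,v):=\Phi(u+v)-\Phi(u)-\Phi'(u)\,v$$ is non-negative and convex on $\{(u,v)\in\mathbb{R}^2:\ u\in I,\ u+v\in I\}$. Let $(E,\mathcal{B},\nu)$ be a measure space with $\nu$ $\sigma$-finite, and let $(\Omega,\mathcal{C},\mathbf{P})$ be the Poisson space over $[0,1]\times E$ with intensity (compensation) measure $\mu(dt,dz)=dt\otimes\nu(dz)$. Then for every $I$-valued random variable $G\in L^2(\Omega,\mathbf{P})$ with $G>\inf I$, $$\mathrm{Ent}^\Phi_{\mathbf{P}}(G)\le\mathbb{E}_{\mathbf{P}}\left(\int_0^1\!\!\int_E\Psi\big(G,D_{t,z}G\big)\,dt\,d\nu(z)\right),$$ where $D_{t,z}G(\omega):=G(\omega+\delta_{(t,z)})-G(\omega)$.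
   Context: For a probability measure $\mathbf{P}$ and an integrable $I$-valued $G$, $\mathrm{Ent}^\Phi_{\mathbf{P}}(G):=\mathbb{E}_{\mathbf{P}}(\Phi(G))-\Phi(\mathbb{E}_{\mathbf{P}}(G))\in[0,+\infty]$. The Poisson space $(\Omega,\mathcal{C},\mathbf{P})$ over $([0,1]\times E,\ \mathcal{B}([0,1])\otimes\mathcal{B},\ \mu)$ is the space of integer-valued point measures $\omega$ on $[0,1]\times E$, with the $\sigma$-field generated by the maps $\omega\mapsto\omega(A)$, under the law $\mathbf{P}$ of a Poisson random measure with intensity $\mu$. *)

(* Defs.v *)
From HB Require Import structures.
From mathcomp Require Import all_boot all_order all_algebra.
From mathcomp Require Import all_classical all_reals all_analysis.
From mathcomp Require Import measurable_realfun.

Set Implicit Arguments.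
Unset Strict Implicit.
Unset Printing Implicit Defensive.

Import Order.TTheory GRing.Theory Num.Theory.
Import numFieldNormedType.Exports.

Local Open Scope classical_set_scope.
Local Open Scope ring_scope.

Definition unitI (R : realType) : Type := {x : R | 0 <= x <= 1}.

Section unit_interval.
Context (R : realType).
Implicit Types A : set (unitI R).

HB.instance Definition _ := Choice.on (unitI R).

Let zero_in01 : 0 <= (0 : R) <= 1. Proof. by rewrite lexx ler01. Qed.

HB.instance Definition _ := isPointed.Build (unitI R)
  (exist (fun x : R => is_true (0 <= x <= 1)) 0 zero_in01).

Definition unitI_val : unitI R -> R := val.

Definition unitI_display : measure_display.
Proof. by constructor. Qed.

Definition unitI_measurable : set (set (unitI R)) :=
  preimage_set_system setT unitI_val measurable.

Let sigma_unitI : sigma_algebra setT unitI_measurable.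
Proof. exact/sigma_algebra_preimage/sigma_algebra_measurable. Qed.

Let unitI_measurable0 : unitI_measurable set0.
Proof. by case: sigma_unitI. Qed.

Let unitI_measurableC A : unitI_measurable A -> unitI_measurable (~` A).
Proof. by case: sigma_unitI => _ + _ => /[apply]; rewrite setTD. Qed.

Let unitI_measurableU (F : (set (unitI R))^nat) :
  (forall i, unitI_measurable (F i)) -> unitI_measurable (\bigcup_i F i).
Proof. by case: sigma_unitI => _ _; exact. Qed.

HB.instance Definition _ :=
  @isMeasurable.Build unitI_display (unitI R) unitI_measurable
    unitI_measurable0 unitI_measurableC unitI_measurableU.

Definition leb01 A : \bar R := lebesgue_measure (unitI_val @` A).

Let image_preimage (B : set R) :
  unitI_val @` (unitI_val @^-1` B) = B `&` `[0, 1].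
Proof.
apply/seteqP; split => [_ [[x x01]/= Bx] <-|x [Bx]]; rewrite /= in_itv //=.
by move=> x01; exists (exist _ x x01).
Qed.

Let measurable_image A : measurable A -> measurable (unitI_val @` A).
Proof.
by move=> [B mB <-]; rewrite setTI image_preimage; exact: measurableI.
Qed.

Let leb01_0 : leb01 set0 = 0%E.
Proof. by rewrite /leb01 image_set0 measure0. Qed.

Let leb01_ge0 A : (0 <= leb01 A)%E.
Proof. exact: measure_ge0. Qed.

Let leb01_sigma_additive : semi_sigma_additive leb01.
Proof.
move=> F mF tF mUF; rewrite /leb01 image_bigcup.
apply: measure_semi_sigma_additive.
- by move=> i; exact: measurable_image.
- apply/trivIsetP => i j _ _ ij; rewrite -subset0 => _ [[x Fx <-] [y Fy]].
  move=> /val_inj yx; rewrite {}yx in Fy.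
  by move/trivIsetP : tF => /(_ i j I I ij)/seteqP[+ _] => /(_ x (conj Fx Fy)).
- by rewrite -image_bigcup; exact: measurable_image.
Qed.

HB.instance Definition _ := isMeasure.Build _ _ _
  leb01 leb01_0 leb01_ge0 leb01_sigma_additive.

Let leb01_setT : leb01 setT = 1%E.
Proof.
rewrite /leb01 -(preimage_setT unitI_val) image_preimage setTI.
by rewrite lebesgue_measure_itv/= lte_fin ltr01 sube0.
Qed.

HB.instance Definition _ := Measure_isProbability.Build _ _ _ leb01 leb01_setT.

End unit_interval.

Arguments leb01 {R}.

Section point_measure.
Context d (X : measurableType d) (R : realType).

(** Finite or countable sums of unit masses; [x] may repeat values, and the
    empty sum ([D = set0]) is allowed. Values on non-measurable sets are left
    unconstrained: they are invisible to the sigma-algebra put on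
    [pointMeasure] below. *)
Definition is_point_measure (m : set X -> \bar R) :=
  exists (D : set nat) (x : nat -> X), forall A, measurable A ->
    m A = (\esum_(i in D) \d_(x i) A)%E.

Record pointMeasure : Type := PointMeasure {
  pm_measure :> {measure set X -> \bar R};
  pm_is_point : is_point_measure pm_measure }.

Let is_point_mzero : is_point_measure (@mzero _ X R).
Proof. by exists set0, (fun=> point) => A _; rewrite esum_set0. Qed.

Definition pm0 : pointMeasure := PointMeasure is_point_mzero.

HB.instance Definition _ := gen_eqMixin pointMeasure.
HB.instance Definition _ := gen_choiceMixin pointMeasure.
HB.instance Definition _ := isPointed.Build pointMeasure pm0.

Definition pm_display : measure_display.
Proof. by constructor. Qed.

Definition pm_measurable : set (set pointMeasure) :=
  <<s \bigcup_(A in measurable)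
        preimage_set_system setT (fun w : pointMeasure => w A) measurable >>.

Let pm_measurable0 : pm_measurable set0.
Proof. exact: sigma_algebra0. Qed.

Let pm_measurableC (U : set pointMeasure) :
  pm_measurable U -> pm_measurable (~` U).
Proof. exact: sigma_algebraC. Qed.

Let pm_measurableU (F : (set pointMeasure)^nat) :
  (forall i, pm_measurable (F i)) -> pm_measurable (\bigcup_i F i).
Proof. exact: sigma_algebra_bigcup. Qed.

HB.instance Definition _ :=
  @isMeasurable.Build pm_display pointMeasure pm_measurable
    pm_measurable0 pm_measurableC pm_measurableU.

Let is_point_add (w : pointMeasure) (a : X) :
  is_point_measure (measure_add w \d_a).
Proof.
have [D [x wE]] := pm_is_point w.
exists (0%N |` (S @` D)), (fun n => if n is k.+1 then x k else a) => A mA.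
have ge0 i : (0 <= \d_(if i is k.+1 then x k else a) A :> \bar R)%E.
  exact: measure_ge0.
rewrite (esumID [set 0%N])//.
have -> : (0%N |` (S @` D)) `&` [set 0%N] = [set 0%N].
  by apply/seteqP; split => [k []|k ->]//; split=> //; left.
have -> : (0%N |` (S @` D)) `&` ~` [set 0%N] = S @` D.
  by apply/seteqP; split => [k [[]]|k [j Dj <-]]//; split=> //; right; exists j.
rewrite esum_set1// measure_addE wE// addeC; congr (_ + _)%E.
by rewrite esum_image// => i j _ _ [].
Qed.

Definition add_point (w : pointMeasure) (a : X) : pointMeasure :=
  PointMeasure (is_point_add w a).

Definition D_ (a : X) (G : pointMeasure -> R) (w : pointMeasure) : R :=
  G (add_point w a) - G w.

End point_measure.

Arguments pointMeasure {d} X R.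

Definition mutually_independent d (T : measurableType d) d'
    (T' : measurableType d') (R : realType) (P : probability T R) (n : nat)
    (Y : 'I_n -> T -> T') :=
  forall B : 'I_n -> set T', (forall i, measurable (B i)) ->
    P (\bigcap_i (Y i @^-1` B i)) = (\prod_(i < n) P (Y i @^-1` B i))%E.

(** The library's [poisson_pmf] is not used: at rate 0 it is constantly 1. *)
Definition poisson_weight (R : realType) (r : R) (k : nat) : R :=
  expR (- r) * r ^+ k / k`!%:R.

(** By convention a Poisson variable with infinite mean is a.s. infinite. *)
Definition is_poisson_law d (X : measurableType d) (R : realType)
    (mu : {measure set X -> \bar R}) (P : probability (pointMeasure X R) R) :=
  [/\ forall A, measurable A -> (mu A < +oo)%E ->
        forall k : nat, P [set w | w A = k%:R%:E] =
                        (poisson_weight (fine (mu A)) k)%:E,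
      forall A, measurable A -> mu A = +oo%E ->
        P [set w | w A = +oo%E] = 1%E
    & forall (n : nat) (A : 'I_n -> set X),
        (forall i, measurable (A i)) -> trivIset setT A ->
        mutually_independent P
          (fun (i : 'I_n) (w : pointMeasure X R) => w (A i))].

Section entropy.
Context (R : realType).
Implicit Types (I : set R) (Phi : R -> R).

Definition diff_quotient (f : R -> R) (x y : R) : R := (f y - f x) / (y - x).

(** The derivative along [I]: two-sided in the interior of [I], one-sided at
    the endpoints that belong to [I]. Its values outside [I] are irrelevant,
    as are those of [f]. *)
Definition derive_in I (f : R -> R) (x : R) : R :=
  lim (diff_quotient f x y @[y --> within I x^']).

Definition smooth_in I (f : R -> R) :=
  forall (k : nat) (x : R), I x ->
    cvg (diff_quotient (iter k (derive_in I) f) x y @[y --> within I x^']).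

Definition Psi I Phi (u v : R) : R :=
  Phi (u + v) - Phi u - derive_in I Phi u * v.

Definition Psi_domain I : set (R^o * R^o) :=
  [set p | I p.1 /\ I (p.1 + p.2)].

(** [Phi (G w)] may have integral [+oo]; its negative part is integrable when
    [G] is, [Phi] being convex. *)
Definition Ent Phi d (T : measurableType d) (P : probability T R)
    (G : T -> R) : \bar R :=
  (\int[P]_w (Phi (G w))%:E - (Phi (fine 'E_P[G]))%:E)%E.

End entropy.

(* Main.v *)
Require Import Defs.
From HB Require Import structures.
From mathcomp Require Import all_boot all_order all_algebra.
From mathcomp Require Import all_classical all_reals all_analysis.
From mathcomp Require Import measurable_realfun ring lra.

Set Implicit Arguments.
Unset Strict Implicit.
Unset Printing Implicit Defensive.

Import Order.TTheory GRing.Theory Num.Theory.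
Import numFieldNormedType.Exports.

Local Open Scope classical_set_scope.
Local Open Scope ring_scope.

(** Write [B(x, y) = Phi y - Phi x - Phi' x (y - x)], so that [Psi(u, v)] is
    [B(u, u + v)] and [Ent G] is [E B(E G, G)]. Convexity and smoothness make [B]
    lie above its tangent planes, which gives Jensen's inequality for [B].

    For finitely many disjoint cells with intensities [lam_k] and for functions
    of the counts, replace the Poisson law by [n] steps of the Markov operator
    [T f = f + (1/n) sum_k lam_k (f o tau_k - f)], where [tau_k] adds a point to
    cell [k]. Convexity of [Phi] gives [T (Phi o f) <= Phi (T f) + (1/n) Gamma f]
    with [Gamma f = sum_k lam_k B(f, f o tau_k)], without error term, and Jensen
    gives [Gamma (T f) <= T (Gamma f)]. Iterating,
    [T^n (Phi o h) <= Phi (T^n h) + T^(n-1) (Gamma h)], and [n -> oo] is the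
    inequality for [h] of the counts, as binomials tend to Poisson.

    For general [G], let [g] be its conditional mean given the counts [N]. By
    Mecke's formula, [(g(N), g(tau_k N))] averages [(G w, G (w + delta_x))] over
    [x] in cell [k], so by Jensen the right-hand side for [g] is at most the one
    for [G]. These conditional means approximate [G] in [L1], and Fatou's lemma
    concludes. *)

(** * Tangent planes of the Bregman divergence *)

(** Time is discrete because powers of [T] at the empty state are finite sums: every inequality for
    a fixed number of steps is algebra and positivity, with no differentiation under an integral.
    The price is the limit [n -> oo] for an unbounded [h]. It is affordable because, conditionally
    on the total number of colored points, the chain and the Poisson configuration have the same law
    of counts. Only the laws of the total are compared, and the binomial density with respect to the
    Poisson law is bounded by a constant that tends to 1, so integrability of the function itself is
    enough for the limit.

    The estimates are stated for [B >= 0] rather than for [Phi o G], whose sign and integrability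
    are unknown. Infinite integrals then make sense, and lower bounds by partial sums or by Fatou's
    lemma apply.

    The interval may contain its endpoints, where derivatives are one-sided. Tangent planes are
    therefore obtained from chords inside [I]. *)

Section derivative_along_interval.
Context (R : realType) (I : set R).
Hypothesis Iitv : is_interval I.
Implicit Types f : R -> R.

Definition derivable_in f (x : R) :=
  cvg (diff_quotient f x y @[y --> within I x^']).

Lemma interval_segment (x y t : R) : I x -> I y -> 0 <= t <= 1 ->
  I (x + t * (y - x)).
Proof.
move=> Ix Iy /andP[t0 t1]; have [xy|yx] := leP x y.
  by apply: (Iitv Ix Iy); nra.
by apply: (Iitv Iy Ix); nra.
Qed.

(** The points [x + (y - x) / n.+1] stay on the segment, hence in [I]. Directional derivatives are
    thus available at the endpoints of [I] too, where the limit is one-sided. *)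
Lemma cvg_chord f (x y : R) : I x -> I y -> derivable_in f x ->
  (fun n => (f (x + n.+1%:R^-1 * (y - x)) - f x) * n.+1%:R) @ \oo -->
  derive_in I f x * (y - x).
Proof.
move=> Ix Iy dfx.
have [->|yx] := eqVneq y x.
  rewrite subrr mulr0; apply: cvg_near_cst; near=> n.
  by rewrite mulr0 addr0 subrr mul0r.
pose u (n : nat) := x + n.+1%:R^-1 * (y - x).
have ux n : u n - x = n.+1%:R^-1 * (y - x) by rewrite /u addrC addKr.
have ux0 n : u n != x.
  by rewrite -subr_eq0 ux mulf_neq0// ?invr_eq0 ?pnatr_eq0// subr_eq0.
rewrite (_ : (fun n => _) = (fun n => diff_quotient f x (u n) * (y - x))).
  apply: cvgM; last exact: cvg_cst.
  apply: cvg_comp; last exact: dfx.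
  move=> A /=; rewrite /within/= => /= nA.
  have ucvg : u @ \oo --> x.
    rewrite -[X in _ --> X](addr0 x); apply: cvgD; first exact: cvg_cst.
    rewrite -(mul0r (y - x)); apply: cvgM; last exact: cvg_cst.
    exact: cvg_harmonic.
  have nA' : \forall n \near \oo, u n != x -> I (u n) -> A (u n) := ucvg _ nA.
  rewrite nbhs_filterE /=; near=> n.
  suff : A (u n) by [].
  have An : u n != x -> I (u n) -> A (u n) by near: n; exact: nA'.
  apply: An; first exact: ux0.
  apply: interval_segment => //; rewrite invr_ge0 ler0n/= invf_le1 ?ltr0n//.
  by rewrite ler1n.
apply/funext => n; rewrite /diff_quotient ux invfM invrK mulrA -mulrA.
by rewrite mulVf ?subr_eq0// mulr1.
Unshelve. all: by end_near. Qed.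

Lemma continuous_in f : (forall x, I x -> derivable_in f x) ->
  {within I, continuous f}.
Proof.
move=> df; apply/subspace_continuousP => x Ix; have := df _ Ix => dfx.
have fx : f y @[y --> within I x^'] --> f x.
  have yx : y @[y --> within I x^'] --> x.
    move=> B nB; rewrite /= /within /dnbhs /within /=.
    by apply: filterS nB => y By _ _.
  have h : diff_quotient f x y * (y - x) + f x @[y --> within I x^'] -->
      derive_in I f x * (x - x) + f x.
    apply: cvgD; last exact: cvg_cst.
    apply: cvgM; first exact: dfx.
    by apply: cvgB => //; exact: cvg_cst.
  rewrite subrr mulr0 add0r in h; apply: cvg_trans h; apply: near_eq_cvg.
  suff: nbhs x (fun y => y != x -> I y -> diff_quotient f x y * (y - x) + f x = f y).
    by [].
  apply: filterE => y xy Iy.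
  by rewrite /diff_quotient divfK ?subrK// subr_eq0.
move=> A nA.
have h : nbhs x (fun y => y != x -> I y -> A (f y)) := fx _ nA.
suff: nbhs x (fun y => I y -> A (f y)) by [].
apply: filterS h => y; have [-> _ _|yx] := eqVneq y x; last exact.
exact: nbhs_singleton.
Qed.

End derivative_along_interval.

Section supporting_plane.
Context (R : realType) (I : set R).
Hypothesis Iitv : is_interval I.
Variables Phi : R -> R.
Hypothesis Phi_smooth : smooth_in I Phi.
Hypothesis Psi_convex : convex_function (Psi_domain I)
                  (fun p => Psi I Phi p.1 p.2).

Definition Bregman (x y : R) : R := Psi I Phi x (y - x).

Local Notation dPhi := (derive_in I Phi).
Local Notation ddPhi := (derive_in I dPhi).

Lemma BregmanE x y : Bregman x y = Phi y - Phi x - dPhi x * (y - x).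
Proof. by rewrite /Bregman /Psi (addrC x) subrK. Qed.

Lemma continuous_Phi : {within I, continuous Phi}.
Proof. by apply: continuous_in => x Ix; exact: (@Phi_smooth 0%N x Ix). Qed.

Lemma continuous_dPhi : {within I, continuous dPhi}.
Proof. by apply: continuous_in => x Ix; exact: (@Phi_smooth 1%N _ Ix). Qed.

(** The map [(x, y) -> (x, y - x)] is linear, so joint convexity passes from [Psi] to [Bregman], and
    the domain becomes the square of [I]. *)
Lemma Bregman_convex (x0 y0 x y t : R) : I x0 -> I y0 -> I x -> I y ->
  0 <= t <= 1 ->
  Bregman (x0 + t * (x - x0)) (y0 + t * (y - y0)) <=
  t * Bregman x y + (1 - t) * Bregman x0 y0.
Proof.
move=> Ix0 Iy0 Ix Iy t01.
have t01' := t01; case/andP: t01' => t0 t1.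
pose T : {i01 R} := Itv01 t0 t1.
have D u v : I u -> I v -> (u, v - u) \in Psi_domain I.
  by rewrite inE /Psi_domain/= => Iu Iv; split=> //; rewrite (addrC u) subrK.
have := @Psi_convex T (x, y - x) (x0, y0 - x0) (D _ _ Ix Iy) (D _ _ Ix0 Iy0).
rewrite /Bregman => H.
have -> : y0 + t * (y - y0) - (x0 + t * (x - x0)) =
    t * (y - x) + (1 - t) * (y0 - x0) by ring.
have -> : x0 + t * (x - x0) = t * x + (1 - t) * x0 by ring.
exact: H.
Qed.

(* Compare the chord from [(x0, y0)] to [(x, y)] with the directional derivative. *)
Lemma Bregman_support (x0 y0 x y : R) : I x0 -> I y0 -> I x -> I y ->
  Bregman x0 y0 - ddPhi x0 * (y0 - x0) * (x - x0)
    + (dPhi y0 - dPhi x0) * (y - y0) <= Bregman x y.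
Proof.
move=> Ix0 Iy0 Ix Iy.
pose cy n := (Phi (y0 + n.+1%:R^-1 * (y - y0)) - Phi y0) * n.+1%:R.
pose cx n := (Phi (x0 + n.+1%:R^-1 * (x - x0)) - Phi x0) * n.+1%:R.
pose dx n := (dPhi (x0 + n.+1%:R^-1 * (x - x0)) - dPhi x0) * n.+1%:R.
have cyP : cy @ \oo --> dPhi y0 * (y - y0).
  by apply: cvg_chord => //; exact: (@Phi_smooth 0%N _ Iy0).
have cxP : cx @ \oo --> dPhi x0 * (x - x0).
  by apply: cvg_chord => //; exact: (@Phi_smooth 0%N _ Ix0).
have dxP : dx @ \oo --> ddPhi x0 * (x - x0).
  by apply: cvg_chord => //; exact: (@Phi_smooth 1%N _ Ix0).
(* This is [n.+1] times the increment of [Bregman] along the chord, with the product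
   [dPhi x * (y - x)] expanded by the discrete product rule. The term [n.+1%:R^-1 * dx n] is the
   second-order remainder and vanishes in the limit. *)
pose u n := cy n - cx n - (dx n * (y0 - x0)
  + (dPhi x0 + n.+1%:R^-1 * dx n) * ((y - y0) - (x - x0))).
have uP : u @ \oo --> dPhi y0 * (y - y0) - dPhi x0 * (x - x0)
   - (ddPhi x0 * (x - x0) * (y0 - x0)
     + (dPhi x0 + 0 * (ddPhi x0 * (x - x0))) * ((y - y0) - (x - x0))).
  apply: cvgB; first exact: cvgB.
  apply: cvgD; first by apply: cvgM => //; exact: cvg_cst.
  apply: cvgM; last exact: cvg_cst.
  apply: cvgD; first exact: cvg_cst.
  by apply: cvgM => //; exact: cvg_harmonic.
have uE n : u n <= Bregman x y - Bregman x0 y0.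
  have n0 : n.+1%:R != 0 :> R by rewrite pnatr_eq0.
  have n01 : 0 <= (n.+1%:R^-1 : R) <= 1.
    by rewrite invr_ge0 ler0n/= invf_le1 ?ltr0n// ler1n.
  have := Bregman_convex Ix0 Iy0 Ix Iy n01.
  move=> H.
  have {H} : n.+1%:R * (Bregman (x0 + n.+1%:R^-1 * (x - x0))
      (y0 + n.+1%:R^-1 * (y - y0)) - Bregman x0 y0) <=
      Bregman x y - Bregman x0 y0.
    rewrite -[leRHS](mulVKf n0) ler_pM2l ?ltr0n// lerBlDr.
    move: H; move: (Bregman (x0 + _) _) (Bregman x0 y0) (Bregman x y) => a b c; move: (n.+1%:R^-1) => e; lra.
  apply: le_trans; rewrite le_eqVlt; apply/orP; left; apply/eqP.
  rewrite /u /cy /cx /dx !BregmanE; field.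
  by rewrite addrC natr1.
have : limn u <= Bregman x y - Bregman x0 y0.
  by apply: limr_le; [exact: cvgP uP|exact: nearW].
rewrite (cvg_lim _ uP)// mul0r addr0.
move: (Bregman x y) (Bregman x0 y0) => a b; lra.
Qed.

End supporting_plane.

(** * The discrete birth operator *)

Section birth_operator.
Context (R : realType) (S : Type) (K : finType).
Variables (lam : K -> R) (tau : K -> S -> S).
Hypothesis lam_ge0 : forall k, 0 <= lam k.
Hypothesis tauC : forall i j s, tau i (tau j s) = tau j (tau i s).
Implicit Types (f g : S -> R) (e : R).

Definition raise f s := \sum_k lam k * f (tau k s).

(** The operator [T] of the overview, with a free step [e] in place of [1/n]. For [e >= 0] it is a
    Markov average as soon as [e * \sum_k lam k <= 1]. *)
Definition birth e f s := (1 - e * \sum_k lam k) * f s + e * raise f s.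

Lemma raise_affine f g a b s :
  raise (fun t => a * f t + b * g t) s = a * raise f s + b * raise g s.
Proof.
rewrite /raise !mulr_sumr -big_split/=; apply: eq_bigr => k _; ring.
Qed.

Lemma raise_sum n (c : nat -> R) (F : nat -> S -> R) s :
  raise (fun t => \sum_(i < n) c i * F i t) s =
  \sum_(i < n) c i * raise (F i) s.
Proof.
rewrite /raise; under eq_bigr do rewrite mulr_sumr.
rewrite exchange_big/=; apply: eq_bigr => i _; rewrite mulr_sumr.
by apply: eq_bigr => k _; rewrite mulrCA.
Qed.

Lemma iter_raise_ge0 f n s : (forall t, 0 <= f t) -> 0 <= iter n raise f s.
Proof.
move=> f0; elim: n s => //= n ih s.
by apply: sumr_ge0 => k _; exact: mulr_ge0.
Qed.

(** The weights of [birth] sum to 1, so constants are fixed, unlike under [raise]. This is what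
    carries tangent planes through a step. *)
Lemma birth_affine e f g c a b s :
  birth e (fun t => c + a * f t + b * g t) s =
  c + a * birth e f s + b * birth e g s.
Proof.
have -> : birth e (fun t => c + a * f t + b * g t) s =
  birth e (fun t => 1 * (c + a * f t) + b * g t) s.
  by congr birth; apply/funext => t; rewrite mul1r.
rewrite /birth raise_affine.
have -> : raise (fun t => c + a * f t) s = c * \sum_k lam k + a * raise f s.
  by rewrite /raise !mulr_sumr -big_split/=; apply: eq_bigr => k _; ring.
ring.
Qed.

(** The order in which points are added does not matter. This plays the part of the commutation
    between gradient and semigroup. *)
Lemma birth_tau e f k s : birth e (fun t => f (tau k t)) s = birth e f (tau k s).
Proof.
rewrite /birth; congr (_ + _ * _); apply: eq_bigr => j _.
by rewrite tauC.
Qed.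

Lemma ler_birth e f g s : 0 <= e -> e * \sum_k lam k <= 1 ->
  (forall t, f t <= g t) -> birth e f s <= birth e g s.
Proof.
move=> e0 e1 fg; apply: lerD; first by rewrite ler_wpM2l ?subr_ge0.
by rewrite ler_wpM2l//; apply: ler_sum => k _; rewrite ler_wpM2l.
Qed.

Lemma iter_birth_affine e f g c a b n s :
  iter n (birth e) (fun t => c + a * f t + b * g t) s =
  c + a * iter n (birth e) f s + b * iter n (birth e) g s.
Proof.
elim: n f g s => // n ih f g s; rewrite 3!iterSr -ih.
by congr (iter n _ _ s); apply/funext => t; rewrite birth_affine.
Qed.

Lemma ler_iter_birth e f g n s : 0 <= e -> e * \sum_k lam k <= 1 ->
  (forall t, f t <= g t) -> iter n (birth e) f s <= iter n (birth e) g s.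
Proof.
move=> e0 e1; elim: n f g s => // n ih f g s fg; rewrite !iterSr.
by apply: ih => t; exact: ler_birth.
Qed.

Definition birth_weight e n i : R :=
  'C(n, i)%:R * (1 - e * \sum_k lam k) ^+ (n - i) * e ^+ i.

(** The binomial theorem for the commuting operators [(1 - e * \sum_k lam k) Id] and [e raise]; the
    recursion [cS] is Pascal's rule. *)
Lemma iter_birthE e f n s :
  iter n (birth e) f s =
  \sum_(i < n.+1) birth_weight e n i * iter i raise f s.
Proof.
pose q := 1 - e * \sum_k lam k.
have cS m i : birth_weight e m.+1 i.+1 =
    q * birth_weight e m i.+1 + e * birth_weight e m i.
  rewrite /birth_weight -/q binS natrD subSS.
  (* For [m <= i] the subtraction [m - i.+1] is truncated, but its coefficient ['C(m, i.+1)] is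
     zero. *)
  have [im|mi] := ltnP i m.
    by rewrite -(subnSK im) !exprS; ring.
  by rewrite (@bin_small m i.+1)// add0r !exprS; ring.
have c0 m : birth_weight e m.+1 0 = q * birth_weight e m 0.
  by rewrite /birth_weight -/q !bin0 !subn0 exprS; ring.
elim: n s => [|n ih] s.
  by rewrite big_ord_recl big_ord0 /birth_weight/= bin0 !expr0; ring.
rewrite iterS {1}/birth -/q ih.
have -> : raise (iter n (birth e) f) s =
    \sum_(i < n.+1) birth_weight e n i * iter i.+1 raise f s.
  rewrite -raise_sum; congr (raise _ s); exact/funext.
rewrite [RHS]big_ord_recl/= c0.
under [in RHS]eq_bigr do rewrite /bump/= cS mulrDl -(mulrA q) -(mulrA e).
rewrite big_split/= -!mulr_sumr addrA; congr (_ + _).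
rewrite -mulrA -mulrDr; congr (_ * _).
transitivity (\sum_(i < n.+2) birth_weight e n i * iter i raise f s).
  by rewrite [RHS]big_ord_recr/= [birth_weight e n n.+1]/birth_weight bin_small// !mul0r addr0.
by rewrite big_ord_recl.
Qed.

(** * Entropy decay along the birth operator *)

Section entropy_production.
Variables (I : set R) (Phi : R -> R).
Hypothesis Iitv : is_interval I.
Hypothesis Phi_smooth : smooth_in I Phi.
Hypothesis Psi_ge0 : forall u v, I u -> I (u + v) -> 0 <= Psi I Phi u v.
Hypothesis Psi_convex : convex_function (Psi_domain I)
                  (fun p => Psi I Phi p.1 p.2).

Lemma Bregman_ge0 x y : I x -> I y -> 0 <= Bregman I Phi x y.
Proof. by move=> Ix Iy; apply: Psi_ge0 => //; rewrite addrC subrK. Qed.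

(** The [Gamma] of the overview. *)
Definition production f s :=
  \sum_k lam k * Bregman I Phi (f s) (f (tau k s)).

Lemma production_ge0 f s : (forall t, I (f t)) -> 0 <= production f s.
Proof.
by move=> If; apply: sumr_ge0 => k _; rewrite mulr_ge0// Bregman_ge0.
Qed.


(** A finite average lies between the least and the greatest of the values averaged; both are
    attained, hence belong to [I]. *)
Lemma birth_in e f s : 0 <= e -> e * \sum_k lam k <= 1 ->
  (forall t, I (f t)) -> I (birth e f s).
Proof.
move=> e0 e1 If.
pose m := \big[Num.min/f s]_k f (tau k s).
pose M := \big[Num.max/f s]_k f (tau k s).
have Im : I m by rewrite /m; elim/big_ind : _ => // x y Ix Iy; case: (leP x y).
have IM : I M by rewrite /M; elim/big_ind : _ => // x y Ix Iy; case: (leP x y).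
have e10 : 0 <= 1 - e * \sum_k lam k by rewrite subr_ge0.
apply: (Iitv Im IM); apply/andP; split.
- have -> : m = (1 - e * \sum_k lam k) * m + e * (\sum_k lam k * m).
    by rewrite -mulr_suml; ring.
  apply: lerD; first by rewrite ler_wpM2l// /m bigmin_le_id.
  rewrite ler_wpM2l//; apply: ler_sum => k _.
  by rewrite ler_wpM2l// /m; exact: bigmin_le_cond.
- have -> : M = (1 - e * \sum_k lam k) * M + e * (\sum_k lam k * M).
    by rewrite -mulr_suml; ring.
  apply: lerD; first by rewrite ler_wpM2l// /M bigmax_ge_id.
  rewrite ler_wpM2l//; apply: ler_sum => k _.
  by rewrite ler_wpM2l// /M; exact: le_bigmax_cond.
Qed.

(** The tangent plane at [(x0, y0)] is affine in [(f t, f (tau k t))], and [birth] averages this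
    pair to [(x0, y0)], by [birth_tau] for the second entry. So [birth] sends the plane to its value
    at the point of contact, and monotonicity concludes. *)
Lemma Bregman_jensen_birth e f k s : 0 <= e -> e * \sum_k lam k <= 1 ->
  (forall t, I (f t)) ->
  Bregman I Phi (birth e f s) (birth e f (tau k s)) <=
  birth e (fun t => Bregman I Phi (f t) (f (tau k t))) s.
Proof.
move=> e0 e1 If.
set x0 := birth e f s; set y0 := birth e f (tau k s).
have Ix0 : I x0 by exact: birth_in.
have Iy0 : I y0 by exact: birth_in.
set a := - (derive_in I (derive_in I Phi) x0 * (y0 - x0)).
set b := derive_in I Phi y0 - derive_in I Phi x0.
have -> : Bregman I Phi x0 y0 =
  birth e (fun t => Bregman I Phi x0 y0 - a * x0 - b * y0
    + a * f t + b * f (tau k t)) s.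
  rewrite birth_affine (birth_tau e f).
  by rewrite -/x0 -/y0; move: (Bregman _ _ _ _) a b => ? ? ?; ring.
apply: ler_birth => // t.
have := @Bregman_support _ _ Iitv _ Phi_smooth Psi_convex x0 y0 (f t) (f (tau k t)) Ix0 Iy0 (If _) (If _).
rewrite -/b.
apply: le_trans; rewrite le_eqVlt; apply/orP; left; apply/eqP.
by rewrite /a; move: (Bregman _ _ _ _) b => ? ?; ring.
Qed.

Lemma production_birth e f s : 0 <= e -> e * \sum_k lam k <= 1 ->
  (forall t, I (f t)) ->
  production (birth e f) s <= birth e (production f) s.
Proof.
move=> e0 e1 If.
have -> : birth e (production f) s =
  \sum_k lam k * birth e (fun t => Bregman I Phi (f t) (f (tau k t))) s.
  rewrite /birth.
  have -> : raise (production f) s =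
    \sum_k lam k * raise (fun t => Bregman I Phi (f t) (f (tau k t))) s.
    rewrite /raise /production; under eq_bigr do rewrite mulr_sumr.
    rewrite exchange_big/=; apply: eq_bigr => k _; rewrite mulr_sumr.
    by apply: eq_bigr => j _; rewrite mulrCA.
  move: (1 - _) => q; rewrite /production !mulr_sumr -big_split/=; apply: eq_bigr => k _.
  by rewrite [RHS]mulrDr [X in _ = X + _]mulrCA [X in _ = _ + X]mulrCA.
by apply: ler_sum => k _; rewrite ler_wpM2l//; exact: Bregman_jensen_birth.
Qed.

(** The left-hand side equals [Phi (f s) + Phi' (f s) (birth e f s - f s) + e * production f s]. The
    first two terms fall short of [Phi (birth e f s)] by a Bregman divergence, which is
    non-negative. *)
Lemma birth_entropy e f s : 0 <= e -> e * \sum_k lam k <= 1 ->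
  (forall t, I (f t)) ->
  birth e (Phi \o f) s <= Phi (birth e f s) + e * production f s.
Proof.
move=> e0 e1 If.
have := Bregman_ge0 (If s) (birth_in s e0 e1 If).
rewrite BregmanE => H.
have -> : birth e (Phi \o f) s = Phi (f s) + derive_in I Phi (f s) * (birth e f s - f s)
   + e * production f s.
  have -> : production f s = raise (Phi \o f) s - Phi (f s) * \sum_k lam k
    - derive_in I Phi (f s) * (raise f s - f s * \sum_k lam k).
    rewrite /raise /production !mulr_sumr -!sumrB mulr_sumr -sumrB.
    by apply: eq_bigr => k _; rewrite BregmanE/=; ring.
  by rewrite /birth/=; ring.
by rewrite lerD2r; move: H; lra.
Qed.

(** Each step costs one [e * production], and by [production_birth] the costs of the later steps are
    bounded by the same iterate. With [e = 1 / n.+1] the factor [n.+1%:R * e] is 1. *)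
Lemma iter_birth_entropy e f n s : 0 <= e -> e * \sum_k lam k <= 1 ->
  (forall t, I (f t)) ->
  iter n.+1 (birth e) (Phi \o f) s <=
  Phi (iter n.+1 (birth e) f s)
    + n.+1%:R * e * iter n (birth e) (production f) s.
Proof.
move=> e0 e1; elim: n f s => [|n ih] f s If.
  by rewrite mul1r; exact: birth_entropy.
have h1 : iter n.+2 (birth e) (Phi \o f) s <=
  iter n.+1 (birth e) (fun t => 0 + 1 * (Phi \o birth e f) t + e * production f t) s.
  rewrite iterSr; apply: ler_iter_birth => // t.
  by rewrite add0r mul1r; exact: birth_entropy.
apply: (le_trans h1); rewrite iter_birth_affine add0r mul1r.
have Ibf t : I (birth e f t) by exact: birth_in.
have := ih (birth e f) s Ibf; rewrite -iterSr.
have : iter n (birth e) (production (birth e f)) s <=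
  iter n.+1 (birth e) (production f) s.
  by rewrite iterSr; apply: ler_iter_birth => // t; exact: production_birth.
move/(ler_wpM2l (mulr_ge0 (ler0n R n.+1) e0)).
rewrite [n.+2%:R]mulrSr.
move: (iter n.+1 (birth e) (Phi \o birth e f) s) (Phi (iter n.+2 (birth e) f s)).
move: (iter n.+1 (birth e) (production f) s) (iter n (birth e) (production (birth e f)) s).
move: n.+1%:R => ? ? ? ? ?; lra.
Qed.

End entropy_production.
End birth_operator.

(** * Configurations and colorings *)

Section fibers.
Local Open Scope ereal_scope.
Context d (T : measurableType d) (R : realType).

Lemma measure_bigcup_finType (mu : {measure set T -> \bar R}) (K : finType)
    (F : K -> set T) : (forall k, measurable (F k)) -> trivIset setT F ->
  mu (\bigcup_k F k) = \sum_k mu (F k).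
Proof.
move=> mF tF; rewrite measure_fin_bigcup//; last exact: finite_finset.
rewrite [RHS]fsbig_seq ?index_enum_uniq//; apply: (congr1 (fun D => \sum_(k \in D) mu (F k))).
by apply/seteqP; split => k //= _; rewrite mem_index_enum.
Qed.

Lemma trivIset_fibers (U V : Type) (D : set U) (f : U -> V) (J : Type) (h : J -> V) :
  injective h -> trivIset setT (fun s : J => D `&` f @^-1` [set h s]).
Proof.
by move=> hI s t _ _ [x [[_ /= fs] [_ /= ft]]]; apply: hI; rewrite -fs -ft.
Qed.

Variables (C : countType).

(** Countable additivity is indexed by [nat], so the fibers of [N] are listed through [pickle];
    integers that code no state give empty fibers. *)
Let pfiber (D : set T) (N : T -> C) (i : nat) := D `&` (pickle \o N) @^-1` [set i].

Let pfiberE D N i : pfiber D N i = set0 \/ exists s : C,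
  pickle s = i /\ pfiber D N i = D `&` N @^-1` [set s].
Proof.
have [[s si]|nsi] := pselect (exists s : C, pickle s = i).
  right; exists s; split=> //; apply/seteqP; split => x [Dx /= h]; split=> //=.
    by apply: (pcan_inj pickleK); rewrite h.
  by rewrite h.
left; rewrite -subset0 => x [_ /= h]; apply: nsi; by exists (N x).
Qed.

Let pfiber_cover D N : \bigcup_i pfiber D N i = D.
Proof.
by apply/seteqP; split => [x [i _ []]//|x Dx]; exists (pickle (N x)).
Qed.

Let pfiber_triv D N : trivIset setT (pfiber D N).
Proof. exact: trivIset_fibers (@inj_id nat). Qed.

Lemma measurable_preimage_fibers (N : T -> C) (S : set C) :
  (forall s, measurable (N @^-1` [set s])) -> measurable (N @^-1` S).
Proof.
move=> mN; rewrite (_ : _ @^-1` _ = \bigcup_(s in S) N @^-1` [set s]).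
  rewrite bigcup_mkcond; apply: countable_bigcupT_measurable => // s.
  by case: ifPn.
by apply/seteqP; split => [x Sx|x [s Ss /= ->]//]; exists (N x).
Qed.

Lemma le_integral_fibers (mu : {measure set T -> \bar R}) (N : T -> C)
    (f g : T -> \bar R) :
  (forall s, measurable (N @^-1` [set s])) ->
  measurable_fun setT f -> measurable_fun setT g ->
  (forall x, 0 <= f x) -> (forall x, 0 <= g x) ->
  (forall s, \int[mu]_(x in N @^-1` [set s]) f x <= \int[mu]_(x in N @^-1` [set s]) g x) ->
  \int[mu]_x f x <= \int[mu]_x g x.
Proof.
move=> mN mf mg f0 g0 fg.
have mpf i : measurable (pfiber setT N i).
  by have [->//|[s [_ ->]]] := pfiberE setT N i; rewrite setTI.
rewrite -(pfiber_cover setT N) !ge0_integral_bigcup//; try exact: pfiber_triv.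
- apply: lee_nneseries => [i _ _|i _].
    by apply: integral_ge0 => x _; exact: f0.
  have [->|[s [_ ->]]] := pfiberE setT N i; first by rewrite !integral_set0.
  by rewrite setTI; exact: fg.
- exact: measurable_funTS.
- exact: measurable_funTS.
Qed.

End fibers.

Lemma eq_measure_fibers d1 (T1 : measurableType d1) d2 (T2 : measurableType d2)
    (R : realType) (C : countType)
    (m1 : {measure set T1 -> \bar R}) (m2 : {measure set T2 -> \bar R})
    (N1 : T1 -> C) (N2 : T2 -> C) (D1 : set T1) (D2 : set T2) :
  (forall s, measurable (N1 @^-1` [set s])) ->
  (forall s, measurable (N2 @^-1` [set s])) ->
  measurable D1 -> measurable D2 ->
  (forall s, m1 (D1 `&` N1 @^-1` [set s]) = m2 (D2 `&` N2 @^-1` [set s])) ->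
  m1 D1 = m2 D2.
Proof.
move=> mN1 mN2 mD1 mD2 m12.
pose F U (N : U -> C) (D : set U) i := D `&` (pickle \o N) @^-1` [set i].
have FE U (N : U -> C) (D : set U) : \bigcup_i F U N D i = D.
  by apply/seteqP; split => [x [i _ []]//|x Dx]; exists (pickle (N x)).
have Fs U (N : U -> C) D s : F U N D (pickle s) = D `&` N @^-1` [set s].
  apply/seteqP; split => x [Dx /= h]; split=> //=; last by rewrite h.
  by apply: (pcan_inj pickleK); rewrite h.
have F0 U (N : U -> C) D i : ~ (exists s : C, pickle s = i) -> F U N D i = set0.
  by move=> nsi; rewrite -subset0 => x [_ /= h]; apply: nsi; exists (N x).
have tF U (N : U -> C) D : trivIset setT (F U N D).
  exact: trivIset_fibers (@inj_id nat).
rewrite -(FE _ N1 D1) -(FE _ N2 D2) !measure_bigcup//.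
- apply: eq_eseriesr => i _.
  have [[s <-]|nsi] := pselect (exists s : C, pickle s = i); first by rewrite !Fs.
  by rewrite !F0// !measure0.
- move=> i _; have [[s <-]|nsi] := pselect (exists s : C, pickle s = i).
    by rewrite !Fs; exact: measurableI.
  by rewrite F0.
- move=> i _; have [[s <-]|nsi] := pselect (exists s : C, pickle s = i).
    by rewrite !Fs; exact: measurableI.
  by rewrite F0.
Qed.

Section configuration_space.
Local Open Scope ereal_scope.
Context d (X : measurableType d) (R : realType).
Local Notation Omega := (pointMeasure X R).
Implicit Types (w : Omega) (A : set X).

Lemma measurable_eval A : measurable A -> measurable_fun setT (fun w => w A).
Proof.
move=> mA _ B mB; apply: sub_sigma_algebra; exists A => //; exists B => //.
Qed.

Lemma add_pointE w x A : add_point w x A = w A + \d_x A.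
Proof. exact: measure_addE. Qed.

Lemma measurable_add_point :
  measurable_fun setT (fun p : Omega * X => add_point p.1 p.2).
Proof.
apply: (@measurability _ _ _ _ _ _ (\bigcup_(A in measurable)
  preimage_set_system setT (fun w : Omega => w A) measurable)) => //.
move=> _ [_ [A mA [B mB <-]] <-]; rewrite !setTI.
suff : measurable_fun setT (fun p : Omega * X => p.1 A + (\1_A p.2)%:E).
  move=> /(_ measurableT _ mB); rewrite setTI; congr measurable.
  have E (p : Omega * X) : p.1 A + (\1_A p.2)%:E = add_point p.1 p.2 A.
    by rewrite add_pointE diracE indicE.
  by apply/seteqP; split => p; rewrite /preimage/mkset E.
apply: emeasurable_funD; first exact: measurableT_comp (measurable_eval mA) _.
by apply/measurable_EFinP; apply: measurableT_comp => //; exact: measurable_indic.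
Qed.

(** The mass of [A] is the number of indices [i] in [D] with [x i] in [A]. *)
Lemma point_measure_nat w A : measurable A ->
  w A = +oo \/ exists n : nat, w A = n%:R%:E.
Proof.
move=> mA; have [D [x wE]] := pm_is_point w.
have -> : w A = counting (D `&` x @^-1` A).
  rewrite wE// counting_dirac nneseries_esumT// esum_mkcond.
  apply: eq_esum => i _; rewrite !diracE.
  case: ifPn => iD; last by rewrite in_setI (negbTE iD).
  by rewrite in_setI iD /=; congr (_%:R%:E); apply/idP/idP; rewrite !inE.
rewrite /counting; case: ifPn => _; last by left.
by right; eexists.
Qed.

End configuration_space.

(** * Colorings, their counts, and the cylinders they generate *)

Section colorings.
Local Open Scope ereal_scope.
Context d (X : measurableType d) (R : realType).
Local Notation Omega := (pointMeasure X R).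
Implicit Types (w : Omega) (A : set X).

(* [None] encodes an infinite count. *)
Definition ecount (y : \bar R) : option nat :=
  if y is r%:E then Some (Num.truncn r) else None.

Definition oval (o : option nat) : \bar R :=
  if o is Some n then n%:R%:E else +oo.

Lemma ovalK : cancel oval ecount.
Proof. by case=> //= n; rewrite natrK. Qed.

Lemma oval_ge0 o : 0 <= oval o. Proof. by case: o => //= n; rewrite lee_fin. Qed.

Lemma ecountK w A : measurable A -> oval (ecount (w A)) = w A.
Proof.
by move=> mA; have [->//|[n ->]] := point_measure_nat w mA; rewrite /= natrK.
Qed.

Section one_coloring.
Context (K : finType).
Implicit Types (c : X -> option K) (s : {ffun K -> option nat}).

(** A map [c : X -> option K] encodes finitely many cells whose disjointness is automatic; [None]
    marks the rest of the space. *)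
Definition color c k := c @^-1` [set Some k].

Definition counts c w := [ffun k => ecount (w (color c k))].

(** The [tau_k] of the overview, acting on states. An infinite count absorbs the added point, and
    the map remains injective. *)
Definition incr k s := [ffun j => if j == k then omap S (s j) else s j].

Lemma incrC i j s : incr i (incr j s) = incr j (incr i s).
Proof. by apply/ffunP => k; rewrite !ffunE; case: eqP; case: eqP. Qed.

Lemma incr_inj k : injective (incr k).
Proof.
move=> s t /ffunP st; apply/ffunP => j; have := st j; rewrite !ffunE.
by case: eqP => // _; case: (s j) (t j) => [?|] [?|]//= [->].
Qed.

Lemma counts_add_point c w x : (forall k, measurable (color c k)) ->
  counts c (add_point w x) =
  if c x is Some k then incr k (counts c w) else counts c w.
Proof.
move=> mc; have E k : counts c (add_point w x) k =
    if c x == Some k then omap S (counts c w k) else counts c w k.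
  rewrite !ffunE add_pointE diracE.
  have -> : (x \in color c k) = (c x == Some k).
    by apply/idP/eqP; rewrite inE.
  have [->|[n ->]] := point_measure_nat w (mc k); first by rewrite if_same.
  by case: eqP => _; rewrite /= -natrD !natrK ?addn0 ?addn1.
case cx: (c x) => [j|]; apply/ffunP => k; rewrite E cx// [RHS]ffunE.
by rewrite eq_sym (inj_eq Some_inj).
Qed.

Lemma countsE c w s : (forall k, measurable (color c k)) ->
  counts c w = s <-> forall k, w (color c k) = oval (s k).
Proof.
move=> mc; split=> [<- k|ws]; first by rewrite ffunE ecountK.
by apply/ffunP => k; rewrite ffunE ws ovalK.
Qed.

Lemma measurable_counts c s : (forall k, measurable (color c k)) ->
  measurable (counts c @^-1` [set s]).
Proof.
move=> mc; rewrite (_ : _ @^-1` _ =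
    \bigcap_k (fun w => w (color c k)) @^-1` [set oval (s k)]).
  apply: fin_bigcap_measurable => [|k _]; first exact: finite_finset.
  rewrite -[X in measurable X]setTI; apply: measurable_eval => //.
apply/seteqP; split => w /= h; first by move=> k _; exact: ((countsE w s mc).1 h k).
by apply/(countsE w s mc) => k; exact: (h k I).
Qed.

Lemma measurable_counts_preimage c (S : set {ffun K -> option nat}) :
  (forall k, measurable (color c k)) -> measurable (counts c @^-1` S).
Proof.
by move=> mc; apply: measurable_preimage_fibers => s; exact: measurable_counts.
Qed.

End one_coloring.

Section coarsening.
Context (K K1 : finType) (r : K -> option K1).
Variables (c : X -> option K) (c1 : X -> option K1).
Hypothesis mc : forall k, measurable (color c k).
Hypothesis c1E : forall x, c1 x = obind r (c x).

Lemma measure_coarse_color (m : {measure set X -> \bar R}) k1 :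
  m (color c1 k1) = \sum_(j | r j == Some k1) m (color c j).
Proof.
have -> : color c1 k1 =
    \bigcup_j (if r j == Some k1 then color c j else set0).
  apply/seteqP; split => [x|x [j _]].
    rewrite /color/= c1E; case cx: (c x) => [j|]//= rj.
    by exists j => //; rewrite rj eqxx.
  by case: eqP => // rj; rewrite /color/= c1E => ->.
rewrite measure_bigcup_finType.
- by rewrite [RHS]big_mkcond; apply: eq_bigr => j _; case: ifPn; rewrite ?measure0.
- by move=> j; case: ifPn.
- move=> i j _ _ [x]; case: ifPn => _; last by case.
  by case: ifPn => _; rewrite /color/= => -[]// -> [].
Qed.

(** Counts are added as extended reals, so one infinite count makes the merged count infinite. *)
Definition coarsen (s : {ffun K -> option nat}) : {ffun K1 -> option nat} :=
  [ffun k1 => ecount (\sum_(j | r j == Some k1) oval (s j))].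

Lemma counts_coarsen w : counts c1 w = coarsen (counts c w).
Proof.
apply/ffunP => k1; rewrite !ffunE measure_coarse_color; congr ecount.
by apply: eq_bigr => j _; rewrite ffunE ecountK.
Qed.

End coarsening.

Variable mu : {measure set X -> \bar R}.

Definition coloring (K : finType) (c : X -> option K) :=
  forall k, measurable (color c k) /\ mu (color c k) < +oo.

(* The color [(None, None)] is never used: a point uncolored by both [c1] and
   [c2] stays uncolored, so that all cells keep a finite measure. *)
Definition joint_coloring (K1 K2 : finType) (c1 : X -> option K1)
    (c2 : X -> option K2) (x : X) : option (option K1 * option K2)%type :=
  if (c1 x, c2 x) is (None, None) then None else Some (c1 x, c2 x).

Lemma joint_coloring1 (K1 K2 : finType) (c1 : X -> option K1)
    (c2 : X -> option K2) x : c1 x = obind fst (joint_coloring c1 c2 x).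
Proof. by rewrite /joint_coloring; case: (c1 x) (c2 x) => [?|] [?|]. Qed.

Lemma joint_coloring2 (K1 K2 : finType) (c1 : X -> option K1)
    (c2 : X -> option K2) x : c2 x = obind snd (joint_coloring c1 c2 x).
Proof. by rewrite /joint_coloring; case: (c1 x) (c2 x) => [?|] [?|]. Qed.

Lemma measurable_uncolored (K : finType) (c : X -> option K) :
  coloring c -> measurable (c @^-1` [set None]).
Proof.
move=> cc; rewrite (_ : _ @^-1` _ = ~` \bigcup_k color c k).
  apply: measurableC; apply: fin_bigcup_measurable => [|k _].
    exact: finite_finset.
  by have [] := cc k.
apply/seteqP; split => x /=; first by move=> cx [k _]; rewrite /color/= cx.
by case cx : (c x) => [k|]// h; exfalso; apply: h; exists k.
Qed.

Lemma coloring_joint (K1 K2 : finType) (c1 : X -> option K1)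
    (c2 : X -> option K2) :
  coloring c1 -> coloring c2 -> coloring (joint_coloring c1 c2).
Proof.
move=> cc1 cc2 [a1 a2].
have m1 : measurable (c1 @^-1` [set a1]).
  by case: a1 => [k|]; [have [] := cc1 k|exact: measurable_uncolored].
have m2 : measurable (c2 @^-1` [set a2]).
  by case: a2 => [k|]; [have [] := cc2 k|exact: measurable_uncolored].
have sub1 : color (joint_coloring c1 c2) (a1, a2) `<=` c1 @^-1` [set a1].
  rewrite /color /joint_coloring => x /=.
  by case: (c1 x) (c2 x) => [?|] [?|]//= [->].
have sub2 : color (joint_coloring c1 c2) (a1, a2) `<=` c2 @^-1` [set a2].
  rewrite /color /joint_coloring => x /=.
  by case: (c1 x) (c2 x) => [?|] [?|]//= [_ ->].
have mj : measurable (color (joint_coloring c1 c2) (a1, a2)).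
  (* A non-empty cell is the intersection of the two given ones: any point of it excludes the pair
     [(None, None)], whose cell is empty although the intersection need not be. *)
  have [->//|ne] := eqVneq (color (joint_coloring c1 c2) (a1, a2)) set0.
  rewrite (_ : color _ _ = c1 @^-1` [set a1] `&` c2 @^-1` [set a2]).
    exact: measurableI.
  apply/seteqP; split => [x h|x [/= h1 h2]]; first by split; [exact: sub1|exact: sub2].
  move/set0P : ne => [y]; rewrite /color /joint_coloring/= h1 h2.
  by case: (c1 y) (c2 y) => [?|] [?|]//= [<- <-].
split=> //; case: a1 m1 sub1 mj sub2 => [k|] m1 sub1 mj sub2.
  have [_] := cc1 k; apply: le_lt_trans.
  by apply: le_measure; rewrite ?inE.
case: a2 m2 sub1 mj sub2 => [k|] m2 sub1 mj sub2.
  have [_] := cc2 k; apply: le_lt_trans.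
  by apply: le_measure; rewrite ?inE.
rewrite (_ : color _ _ = set0) ?measure0// -subset0 => x.
by rewrite /color /joint_coloring/=; case: (c1 x) (c2 x) => [?|] [?|].
Qed.

Definition set_coloring A (x : X) : option unit :=
  if x \in A then Some tt else None.

Lemma set_coloringE A k : color (set_coloring A) k = A.
Proof.
apply/seteqP; split => x; rewrite /color /set_coloring/=.
  by case: ifPn => [/set_mem//|].
by move=> Ax; rewrite mem_set//; case: k.
Qed.

Lemma coloring_set A : measurable A -> mu A < +oo -> coloring (set_coloring A).
Proof. by move=> mA fA k; rewrite set_coloringE. Qed.

(** The set [S] of states may be arbitrary because there are countably many states; cells of finite
    intensity keep the Poisson weights available. *)
Definition cylinders : set (set Omega) :=
  [set C | exists (K : finType) (c : X -> option K) S,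
    coloring c /\ C = counts c @^-1` S].

Lemma coarsen_counts (K1 K2 : finType) (c1 : X -> option K1)
    (c2 : X -> option K2) : coloring c1 -> coloring c2 ->
  (forall w, counts c1 w = coarsen fst (counts (joint_coloring c1 c2) w)) /\
  (forall w, counts c2 w = coarsen snd (counts (joint_coloring c1 c2) w)).
Proof.
move=> cc1 cc2; have cj := coloring_joint cc1 cc2.
have mj k : measurable (color (joint_coloring c1 c2) k) by have [] := cj k.
split => w; apply: counts_coarsen => // x.
  exact: joint_coloring1.
exact: joint_coloring2.
Qed.

(** Both cylinders can be read off the counts of a common refinement of the two colorings. *)
Lemma setI_closed_cylinders : setI_closed cylinders.
Proof.
move=> _ _ [K1 [c1 [S1 [cc1 ->]]]] [K2 [c2 [S2 [cc2 ->]]]].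
exists (option K1 * option K2)%type, (joint_coloring c1 c2),
  (coarsen fst @^-1` S1 `&` coarsen snd @^-1` S2).
split; first exact: coloring_joint.
have [e1 e2] := coarsen_counts cc1 cc2.
by apply/seteqP; split => w /=; rewrite e1 e2.
Qed.

Lemma cylindersT : cylinders setT.
Proof.
exists void, (fun=> None), setT; split; first by case.
by apply/seteqP; split.
Qed.

(** By sigma-finiteness, [w A] is the countable sum of the masses of pieces of [A] of finite
    intensity, and each of these is measurable for the cylinders. *)
Lemma measurable_cylinders : sigma_finite setT mu ->
  @measurable _ Omega = <<s cylinders >>.
Proof.
move=> [F FT mF]; apply/seteqP; split; last first.
  apply: smallest_sub; first exact: sigma_algebra_measurable.
  move=> _ [K [c [S [cc ->]]]]; apply: measurable_counts_preimage => k.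
  by have [] := cc k.
apply: smallest_sub; first exact: smallest_sigma_algebra.
move=> _ [A mA [B mB <-]].
pose T := g_sigma_algebraType cylinders.
have evalfin A' : measurable A' -> mu A' < +oo ->
    measurable_fun setT (fun w : T => (w : Omega) A').
  move=> mA' fA' _ V mV; rewrite setTI; apply: sub_sigma_algebra.
  exists unit, (set_coloring A'), [set s | V (oval (s tt))]; split.
    exact: coloring_set.
  by apply/seteqP; split => w /=; rewrite ffunE set_coloringE ecountK.
have mD i : measurable (seqDU F i) by apply: seqDU_measurable => // j; have [] := mF j.
have AE w : w A = \sum_(i <oo) w (A `&` seqDU F i).
  rewrite -[in LHS](setIT A) FT seqDU_bigcup_eq setI_bigcupr measure_bigcup//.
  - by apply: eq_eseriesl => i; rewrite in_setT.
  - by move=> i _; exact: measurableI.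
  - by apply: trivIset_setIl; exact: trivIset_seqDU.
suff : measurable_fun setT (fun w : T => (w : Omega) A) by move/(_ measurableT _ mB).
under eq_fun do rewrite AE.
apply: ge0_emeasurable_sum => //= i _.
apply: evalfin; first exact: measurableI.
have [mFi] := mF i; apply: le_lt_trans; apply: le_measure; rewrite ?inE//.
  exact: measurableI.
by move=> x [_ h]; exact: (subset_seqDU h).
Qed.

End colorings.

(** * Mecke's formula *)

Section poisson_weight.
Local Open Scope ereal_scope.
Context (R : realType).

Lemma poisson_weight_ge0 (r : R) k : (0 <= r)%R -> (0 <= poisson_weight r k)%R.
Proof.
by move=> r0; rewrite /poisson_weight divr_ge0// mulr_ge0 ?expR_ge0 ?exprn_ge0.
Qed.

(** Mecke's formula for a single count: choosing a new point on top of [k] amounts to marking one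
    point among [k.+1]. *)
Lemma poisson_weightS (r : R) k :
  (poisson_weight r k * r = k.+1%:R * poisson_weight r k.+1)%R.
Proof.
rewrite /poisson_weight factS natrM exprS; field.
by rewrite nat1r !pnatr_eq0 andbT -lt0n fact_gt0.
Qed.

Lemma nneseries_poisson_weight (r : R) : (0 <= r)%R ->
  \sum_(k <oo) (poisson_weight r k)%:E = 1.
Proof.
move=> r0; rewrite [RHS](_ : _ = (expR (- r))%:E * (expR r)%:E); last first.
  by rewrite -EFinM expRN mulVf ?gt_eqF ?expR_gt0.
under eq_eseriesr do rewrite /poisson_weight -mulrA EFinM.
rewrite nneseriesZl/=; last first.
  by move=> n _; rewrite lee_fin divr_ge0// exprn_ge0.
congr *%E; rewrite expRE -EFin_lim; last first.
  rewrite /pseries/=; under eq_fun do rewrite mulrC.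
  exact: is_cvg_series_exp_coeff.
apply/congr_lim/funext => n/=; rewrite /pseries/= /series/= -sumEFin//.
by under eq_bigr do rewrite mulrC.
Qed.

End poisson_weight.

Section poisson_law.
Local Open Scope ereal_scope.
Context d (X : measurableType d) (R : realType).
Local Notation Omega := (pointMeasure X R).
Variables (mu : {sigma_finite_measure set X -> \bar R}) (P : probability Omega R).
Hypothesis P_poisson : is_poisson_law mu P.

Lemma poisson_finite_count (B : set X) (k : nat) : measurable B -> mu B < +oo ->
  P [set w : Omega | w B = k%:R%:E] = (poisson_weight (fine (mu B)) k)%:E.
Proof. by have [law _ _] := P_poisson => mB fB; exact: law. Qed.

(** The finite counts already carry total mass 1. *)
Lemma poisson_infinite_count (B : set X) : measurable B -> mu B < +oo ->
  P [set w : Omega | w B = +oo] = 0.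
Proof.
move=> mB fB.
have mk (y : \bar R) : measurable [set w : Omega | w B = y].
  rewrite -[X in measurable X]setTI.
  exact: (measurable_eval mB measurableT (emeasurable_set1 y)).
have -> : [set w : Omega | w B = +oo] =
    ~` (\bigcup_k [set w : Omega | w B = k%:R%:E]).
  apply/seteqP; split => [w /= wB [k _ /=]|w /=]; first by rewrite wB.
  by have [//|[n wn] h] := point_measure_nat w mB; exfalso; apply: h; exists n.
rewrite probability_setC ?measure_bigcup//.
- under eq_eseriesl do rewrite in_setT.
  rewrite (eq_eseriesr (g := fun k => (poisson_weight (fine (mu B)) k)%:E)); last first.
    by move=> k _; exact: poisson_finite_count.
  by rewrite nneseries_poisson_weight ?subee// fine_ge0.
- by move=> i j _ _ [w [/= -> /= []]] /eqP; rewrite eqr_nat => /eqP.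
- exact: bigcup_measurable.
Qed.

Section coloring_law.
Context (K : finType) (c : X -> option K).
Hypothesis cc : coloring mu c.
Implicit Types s : {ffun K -> option nat}.

Let mc k : measurable (color c k). Proof. by have [] := cc k. Qed.

Definition intensity k : R := fine (mu (color c k)).

Lemma intensityE k : mu (color c k) = (intensity k)%:E.
Proof.
by have [_ h] := cc k; rewrite /intensity fineK// ge0_fin_numE.
Qed.

Lemma intensity_ge0 k : (0 <= intensity k)%R.
Proof. exact: fine_ge0. Qed.

Definition state_weight s k : R :=
  if s k is Some n then poisson_weight (intensity k) n else 0%R.

Lemma law_counts s :
  P (counts c @^-1` [set s]) = (\prod_k state_weight s k)%:E.
Proof.
have [_ _ indep] := P_poisson.
have [[k sk]|sS] := pselect (exists k, s k = None).
  rewrite (bigD1 k)//= /state_weight sk mul0r.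
  apply/eqP; rewrite eq_le measure_ge0 andbT.
  have [_ fk] := cc k.
  apply: (@le_trans _ _ (P [set w : Omega | w (color c k) = +oo])); last first.
    by rewrite poisson_infinite_count.
  apply: le_measure; rewrite ?inE.
  - exact: measurable_counts.
  - rewrite -[X in measurable X]setTI.
    exact: (measurable_eval (mc k) measurableT (emeasurable_set1 _)).
  - by move=> w /= /(countsE w s mc)/(_ k); rewrite sk.
(* Independence in [is_poisson_law] concerns families indexed by ordinals, so the cells are
   enumerated. *)
pose A (i : 'I_#|K|) := color c (enum_val i).
have -> : counts c @^-1` [set s] =
    \bigcap_i ((fun w : Omega => w (A i)) @^-1` [set oval R (s (enum_val i))]).
  apply/seteqP; split => w /=.
    by move=> /(countsE w s mc) h i _; exact: h.
  move=> h; apply/(countsE w s mc) => k.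
  by have := h (enum_rank k) I; rewrite /A/= enum_rankK.
have mA i : measurable (A i) by exact: mc.
have tA : trivIset setT A.
  by move=> i j _ _ [x []]; rewrite /A /color/= => -> [] /enum_val_inj.
rewrite (indep _ A mA tA (fun i => [set oval R (s (enum_val i))]))//.
rewrite (reindex (@enum_val K K)) /=; last first.
  by exists enum_rank => i _; [exact: enum_valK|exact: enum_rankK].
rewrite (big_morph EFin EFinM (erefl _)).
apply: eq_bigr => i _; rewrite /state_weight.
have [_ fk] := cc (enum_val i).
case sk : (s (enum_val i)) => [n|]; last by exfalso; apply: sS; exists (enum_val i).
by rewrite /= -poisson_finite_count.
Qed.

(** Adding a point of color [k] leads to [s] exactly from the state [s'] with one point less in cell
    [k]. The event is therefore a rectangle, and [poisson_weightS] converts the weight of [s'] into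
    that of [s]. For [m = 0] no such predecessor exists. *)
Lemma mecke_state s k m : s k = Some m ->
  (P \x mu) [set p | counts c (add_point p.1 p.2) = s /\ c p.2 = Some k] =
  m%:R%:E * P (counts c @^-1` [set s]).
Proof.
case: m => [|m] sk.
  rewrite mul0e (_ : [set _ | _] = set0) ?measure0//.
  rewrite -subset0 => -[w x] /= [+ cx]; rewrite counts_add_point// cx.
  by move/ffunP/(_ k); rewrite ffunE eqxx sk; case: (counts c w k).
pose s' := [ffun j => if j == k then Some m else s j].
have ss' : incr k s' = s.
  by apply/ffunP => j; rewrite !ffunE; case: eqP => // ->; rewrite sk.
have -> : [set p : Omega * X | counts c (add_point p.1 p.2) = s /\ c p.2 = Some k] =
    (counts c @^-1` [set s']) `*` color c k.
  apply/seteqP; split => -[w x] /= [].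
    by rewrite counts_add_point// => + cx; rewrite cx -ss' => /incr_inj.
  by rewrite counts_add_point// /color/= => -> ->.
rewrite product_measure1E//; last exact: measurable_counts.
rewrite intensityE law_counts.
transitivity ((\prod_k state_weight s' k)%:E * (intensity k)%:E).
  by congr (_ * _); exact: law_counts.
rewrite -!EFinM; congr EFin.
rewrite (bigD1 k)//= [in RHS](bigD1 k)//= mulrA mulrAC.
have -> : state_weight s' k = poisson_weight (intensity k) m.
  by rewrite /state_weight ffunE eqxx.
have -> : state_weight s k = poisson_weight (intensity k) m.+1.
  by rewrite /state_weight sk.
rewrite poisson_weightS; congr (_ * _)%R; apply: eq_bigr => j jk.
by rewrite /state_weight ffunE (negbTE jk).
Qed.

End coloring_law.
End poisson_law.

Section transfer.
Local Open Scope ereal_scope.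
Context (R : realType).

Lemma ge0_integral_mrestr d (T : measurableType d)
    (m : {measure set T -> \bar R}) (D : set T) (mD : measurable D)
    (f : T -> \bar R) : measurable_fun setT f -> (forall x, 0 <= f x) ->
  \int[mrestr m mD]_x f x = \int[m]_(x in D) f x.
Proof.
move=> mf f0; rewrite (@ge0_negligible_integral _ _ _ _ setT (~` D))//.
- rewrite setTD setCK; apply: eq_measure_integral => A mA AD.
  by rewrite /= /mrestr (setIidl AD).
- exact: measurableC.
- by rewrite /= /mrestr setICl measure0.
Qed.

Lemma ge0_integral_transfer d1 (T1 : measurableType d1) d2 (T2 : measurableType d2)
    (m1 : {measure set T1 -> \bar R}) (m2 : {measure set T2 -> \bar R})
    (E : set T1) (phi : T1 -> T2) (f : T2 -> \bar R) :
  measurable E -> measurable_fun setT phi ->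
  (forall C, measurable C -> m1 (phi @^-1` C `&` E) = m2 C) ->
  measurable_fun setT f -> (forall x, 0 <= f x) ->
  \int[m1]_(x in E) f (phi x) = \int[m2]_y f y.
Proof.
move=> mE mphi m12 mf f0.
rewrite -(ge0_integral_mrestr m1 mE (f := f \o phi)); last 2 first.
- exact: measurableT_comp.
- by move=> x; exact: f0.
have mphi_mixin := isMeasurableFun.Build _ _ _ _ _ mphi.
pose phi' : {mfun T1 >-> T2} := HB.pack phi mphi_mixin.
rewrite (@eq_measure_integral _ _ _ _ (pushforward (mrestr m1 mE) phi') m2)//.
  by rewrite ge0_integral_pushforward.
by move=> C mC _; rewrite -m12.
Qed.

End transfer.

Section mecke.
Local Open Scope ereal_scope.
Context d (X : measurableType d) (R : realType).
Local Notation Omega := (pointMeasure X R).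
Variables (mu : {sigma_finite_measure set X -> \bar R}) (P : probability Omega R).
Hypothesis P_poisson : is_poisson_law mu P.
Variables (B : set X) (m : nat).
Hypotheses (mB : measurable B) (fB : mu B < +oo).

Let add (p : Omega * X) : Omega := add_point p.1 p.2.

Let madd : measurable_fun setT add. Proof. exact: measurable_add_point. Qed.

(** Mecke's formula is localized on the event that [B] holds exactly [m] points: the random factor
    [w B] becomes the constant [m], and both sides become finite measures. *)
Definition hits : set Omega := [set w : Omega | w B = m%:R%:E].

Definition hits_after_adding : set (Omega * X) :=
  [set p | hits (add_point p.1 p.2) /\ B p.2].

Lemma measurable_hits : measurable hits.
Proof.
rewrite -[hits]setTI.
exact: (measurable_eval mB measurableT (emeasurable_set1 _)).
Qed.

Lemma measurable_add_preimage (C : set Omega) : measurable C ->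
  measurable (add @^-1` C).
Proof. by move=> mC; rewrite -[X in measurable X]setTI; exact: madd. Qed.

Lemma measurable_hits_after_adding : measurable hits_after_adding.
Proof.
apply: measurableI; first exact: (measurable_add_preimage measurable_hits).
rewrite -[X in measurable X]setTI; exact: measurable_snd.
Qed.

Lemma measurable_color_snd (K : finType) (c : X -> option K) k :
  coloring mu c -> measurable [set p : Omega * X | c p.2 = Some k].
Proof.
move=> cc; have [mc _] := cc k.
have h : measurable (setT `&` @snd Omega X @^-1` color c k) by exact: measurable_snd.
by rewrite setTI in h.
Qed.

Lemma coarsen_Some (K K1 : finType) (r : K -> option K1) s k1 :
  coarsen R r s k1 = Some m ->
  (forall j, r j = Some k1 -> s j != None) /\
  (\sum_(j | r j == Some k1) odflt 0 (s j))%N = m.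
Proof.
rewrite ffunE => H.
have S0 j : r j = Some k1 -> s j != None.
  move=> rj; apply/eqP => sj; move: H; rewrite (bigD1 j)/=; last exact/eqP.
  rewrite sj/= addye//; rewrite gt_eqF//.
  by apply: (@lt_le_trans _ _ 0) => //; apply: sume_ge0 => i _; exact: oval_ge0.
split=> //; move: H; rewrite (eq_bigr (fun j => (odflt 0%N (s j))%:R%:E)).
  by rewrite sumEFin -natr_sum/= natrK => -[].
by move=> j /eqP/S0; case: (s j).
Qed.

(** After refining the coloring of [C] by [B], both events split over the states [s] of the
    refinement. For a given [s], [mecke_state] gives a factor [s j] for each cell [j] inside [B],
    and these factors add up to [m]. *)
Lemma mecke_cylinder C : cylinders mu C ->
  (P \x mu) (add @^-1` C `&` hits_after_adding) = m%:R%:E * P (C `&` hits).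
Proof.
move=> [K0 [c0 [S0 [cc0 CE]]]].
have ccB := coloring_set mB fB.
pose c := joint_coloring c0 (set_coloring B).
have cc : coloring mu c by exact: coloring_joint.
have [e0 eB] := coarsen_counts cc0 ccB.
have mc k : measurable (color c k) by have [] := cc k.
have mC : measurable C.
  by rewrite CE; apply: measurable_counts_preimage => k; have [] := cc0 k.
pose good s := S0 (coarsen R fst s) /\ coarsen R snd s tt = Some m.
have goodE w : (C `&` hits) w <-> good (counts c w).
  rewrite /good -e0 -eB CE; apply: and_iff_compat_l.
  rewrite ffunE set_coloringE /hits/=; split => [->|]; first by rewrite /= natrK.
  by move=> h; rewrite -(ecountK w mB) h.
have BE x : B x <-> exists2 j, c x = Some j & j.2 = Some tt.
  split => [Bx|[j cx j2]].
    have := joint_coloring2 c0 (set_coloring B) x; rewrite -/c.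
    rewrite {1}/set_coloring mem_set//; case cx : (c x) => [j|]//= j2.
    by exists j.
  have := joint_coloring2 c0 (set_coloring B) x; rewrite -/c cx/= j2.
  by rewrite /set_coloring; case: ifPn => // /set_mem.
have maddc s : measurable (add @^-1` (counts c @^-1` [set s])).
  by apply: measurable_add_preimage; exact: measurable_counts.
transitivity (mscale (NngNum (ler0n R m)) P (C `&` hits)) => //.
apply: (@eq_measure_fibers _ _ _ _ R {ffun (option K0 * option unit) -> option nat}
   _ _ (counts c \o add) (counts c)) => //.
- by move=> s; exact: measurable_counts.
- apply: measurableI; first exact: measurable_add_preimage.
  exact: measurable_hits_after_adding.
- by apply: measurableI => //; exact: measurable_hits.
move=> s; have [gs|ngs] := pselect (good s); last first.
  rewrite (_ : _ `&` _ = set0); last first.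
    rewrite -subset0 => -[w x] [[Cw [hw _]] /= ws]; apply: ngs; rewrite -ws.
    by apply/goodE.
  rewrite (_ : C `&` hits `&` _ = set0) ?measure0//.
  by rewrite -subset0 => w [Cw /= ws]; apply: ngs; rewrite -ws; exact/goodE.
have [sS sm] := coarsen_Some gs.2.
rewrite (_ : C `&` hits `&` _ = counts c @^-1` [set s]); last first.
  apply/seteqP; split => [w []//|w /= ws]; split => //; apply/goodE.
  by rewrite ws.
rewrite (_ : add @^-1` C `&` hits_after_adding `&` _ = \bigcup_j (if j.2 == Some tt then
    [set p | counts c (add p) = s /\ c p.2 = Some j] else set0)); last first.
  apply/seteqP; split => [[w x] [[Cw [hw Bx]] /= ws]|[w x] [j _]].
    by have /BE[j cx j2] := Bx; exists j => //; rewrite j2 eqxx.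
  case: eqP => // j2 [/= ws cx]; have Bx : B x by apply/BE; exists j.
  have [Cw hw] : (C `&` hits) (add (w, x)) by apply/goodE; rewrite ws.
  by split.
have mj j : measurable [set p : Omega * X | counts c (add p) = s /\ c p.2 = Some j].
  by apply: measurableI; [exact: maddc|exact: measurable_color_snd].
rewrite measure_bigcup_finType; last 2 first.
- by move=> j; case: ifPn.
- move=> i j _ _ [x []]; case: ifPn => [_ /= [_ xi]|_ []].
  by case: ifPn => [_ /= [_]|_ []]; rewrite xi => -[].
transitivity (m%:R%:E * P (counts c @^-1` [set s])) => //.
rewrite -[in RHS]sm natr_sum -sumEFin ge0_sume_distrl; last first.
  by move=> j _; rewrite lee_fin.
rewrite [RHS]big_mkcond; apply: eq_bigr => j _.
case: ifPn => [/eqP j2|_]; last by rewrite measure0.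
case sj : (s j) (sS j j2) => [n|]// _.
exact: (mecke_state P_poisson cc sj).
Qed.

(** Both sides are measures in [C], finite thanks to the localization, and they agree on a
    generating class closed under intersection. *)
Lemma mecke_set C : measurable C ->
  (P \x mu) (add @^-1` C `&` hits_after_adding) = m%:R%:E * P (C `&` hits).
Proof.
move=> mC.
have mphi_mixin := isMeasurableFun.Build _ _ _ _ _ madd.
pose phi : {mfun (Omega * X)%type >-> Omega} := HB.pack add mphi_mixin.
transitivity (pushforward (mrestr (P \x mu) measurable_hits_after_adding) phi C) => //.
transitivity (mscale (NngNum (ler0n R m)) (mrestr P measurable_hits) C) => //.
apply: (measure_unique (cylinders mu) (fun=> setT)) => //.
- exact: measurable_cylinders (sigma_finiteT mu).
- exact: setI_closed_cylinders.
- by move=> _; exact: cylindersT.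
- by rewrite bigcup_const//; exists 0%N.
- by move=> A cA; exact: mecke_cylinder.
- move=> _; apply: (@le_lt_trans _ _ (m%:R%:E * P (setT `&` hits))).
    by rewrite -(mecke_cylinder (cylindersT mu)).
  rewrite setTI lte_mul_pinfty//.
  by rewrite (le_lt_trans (probability_le1 _ measurable_hits))// ltry.
Qed.

Lemma mecke_integral (f : Omega -> \bar R) :
  measurable_fun setT f -> (forall w, 0 <= f w) ->
  \int[P \x mu]_(p in hits_after_adding) f (add_point p.1 p.2) =
  m%:R%:E * \int[P]_(w in hits) f w.
Proof.
move=> mf f0.
rewrite (@ge0_integral_transfer _ _ _ _ _ _
  (mscale (NngNum (ler0n R m)) (mrestr P measurable_hits)) _ add)//.
- by rewrite ge0_integral_mscale// ge0_integral_mrestr.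
- exact: measurable_hits_after_adding.
- exact: mecke_set.
Qed.

End mecke.

(** * Functions of finitely many counts *)

Section binomial_over_poisson.
Context (R : realType) (L : R).
Hypothesis L_ge0 : 0 <= L.

(* Density of the binomial law of parameters [n] and [L / n] with respect to the
   Poisson law of parameter [L]. *)
Definition binomial_ratio (n k : nat) : R :=
  'C(n, k)%:R * (1 - n%:R^-1 * L) ^+ (n - k) * n%:R^-1 ^+ k * k`!%:R * expR L.

Lemma binomial_ratio_ge0 n k : (0 < n)%N -> L <= n%:R -> 0 <= binomial_ratio n k.
Proof.
move=> n0 Ln; rewrite /binomial_ratio !mulr_ge0 ?expR_ge0 ?exprn_ge0 ?invr_ge0//.
by rewrite subr_ge0 mulrC ler_pdivrMr ?ltr0n// mul1r.
Qed.

(** The left-hand side is the product of the [1 - i/n] for [i < k], and each factor is at most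
    [expR (- i/n)]. *)
Lemma ffact_le_expR n k : (0 < n)%N ->
  (n ^_ k)%:R * n%:R^-1 ^+ k <= expR (- ((k%:R ^+ 2 - k%:R) / (2 * n%:R))) :> R.
Proof.
move=> n0; have n0' : n%:R != 0 :> R by rewrite pnatr_eq0 -lt0n.
elim: k => [|k ih]; first by rewrite ffactn0 expr0 mulr1 expr2 mul0r subrr mul0r oppr0 expR0.
have [kn|nk] := ltnP k n; last first.
  by rewrite ffactnSr (eqP (_ : (n - k)%N == 0%N)) ?subn_eq0// muln0 mul0r expR_ge0.
rewrite ffactnSr natrM exprSr.
have -> : - ((k.+1%:R ^+ 2 - k.+1%:R) / (2 * n%:R)) =
    - ((k%:R ^+ 2 - k%:R) / (2 * n%:R)) + - (k%:R / n%:R) :> R.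
  by rewrite -natr1; field; rewrite ?n0' ?pnatr_eq0.
have h0 : 0 <= (n ^_ k)%:R * n%:R^-1 ^+ k :> R.
  by rewrite mulr_ge0// exprn_ge0// invr_ge0.
have h1 : 0 <= (n - k)%:R * n%:R^-1 :> R by rewrite mulr_ge0// invr_ge0.
rewrite expRD mulrACA; apply: ler_pM => //.
rewrite natrB; last exact: ltnW.
by apply: le_trans (expR_ge1Dx _); rewrite mulrBl divff.
Qed.

(** Once both factors are bounded by exponentials, the exponent is quadratic in [k]. Completing the
    square at [k = L + 1/2] gives a bound uniform in [k]. *)
Lemma binomial_ratio_le n k : (0 < n)%N -> L <= n%:R ->
  binomial_ratio n k <= expR ((L + 2^-1) ^+ 2 / (2 * n%:R)).
Proof.
move=> n0 Ln; have n0' : n%:R != 0 :> R by rewrite pnatr_eq0 -lt0n.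
have n0'' : (0 : R) < n%:R by rewrite ltr0n.
have [kn|nk] := leqP k n; last first.
  by rewrite /binomial_ratio bin_small// !mul0r expR_ge0.
have -> : binomial_ratio n k = (n ^_ k)%:R * n%:R^-1 ^+ k *
    (1 - n%:R^-1 * L) ^+ (n - k) * expR L.
  by rewrite /binomial_ratio -bin_ffact natrM; ring.
have q0 : 0 <= 1 - n%:R^-1 * L.
  by rewrite subr_ge0 mulrC ler_pdivrMr ?ltr0n// mul1r.
have q1 : (1 - n%:R^-1 * L) ^+ (n - k) <= expR (- (n%:R^-1 * L) * (n - k)%:R).
  rewrite expRM_natr; apply: lerXn2r => //.
  - by rewrite nnegrE expR_ge0.
  - exact: expR_ge1Dx.
apply: (@le_trans _ _ (expR (- ((k%:R ^+ 2 - k%:R) / (2 * n%:R)))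
    * expR (- (n%:R^-1 * L) * (n - k)%:R) * expR L)).
  have h0 : 0 <= (n ^_ k)%:R * n%:R^-1 ^+ k :> R.
    by rewrite mulr_ge0// exprn_ge0// invr_ge0.
  have h1 := exprn_ge0 (n - k) q0.
  rewrite ler_wpM2r ?expR_ge0//; apply: ler_pM => //.
  exact: ffact_le_expR.
rewrite -!expRD ler_expR natrB//.
rewrite -subr_ge0.
have -> : (L + 2^-1) ^+ 2 / (2 * n%:R) - (- ((k%:R ^+ 2 - k%:R) / (2 * n%:R)) +
    - (n%:R^-1 * L) * (n%:R - k%:R) + L) = (k%:R - L - 2^-1) ^+ 2 / (2 * n%:R).
  by field; rewrite ?n0' ?pnatr_eq0.
by rewrite divr_ge0 ?sqr_ge0// mulr_ge0.
Qed.

Lemma sum_binomial_ratio n : (0 < n)%N ->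
  \sum_(i < n.+1) binomial_ratio n i * poisson_weight L i = 1.
Proof.
move=> n0; have n0' : n%:R != 0 :> R by rewrite pnatr_eq0 -lt0n.
rewrite -[RHS](expr1n R n) -{1}(subrK (n%:R^-1 * L) 1) exprDn.
apply: eq_bigr => i _; rewrite /binomial_ratio /poisson_weight expRN exprMn.
rewrite -mulr_natl; field; rewrite pnatr_eq0 -lt0n fact_gt0/=.
by rewrite gt_eqF ?expR_gt0.
Qed.

Lemma poisson_weight_partial_sum n : \sum_(i < n) poisson_weight L i <= 1.
Proof.
rewrite -lee_fin -sumEFin -(nneseries_poisson_weight L_ge0).
rewrite -(big_mkord xpredT (fun i => (poisson_weight L i)%:E)).
by apply: nneseries_lim_ge => i _ _; rewrite lee_fin poisson_weight_ge0.
Qed.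

Let C n := expR ((L + 2^-1) ^+ 2 / (2 * n.+1%:R)).

Lemma near_ge_nat (x : R) : \forall n \near \oo, x <= n.+1%:R.
Proof.
near=> n; apply: (@le_trans _ _ n%:R); last by rewrite ler_nat.
by near: n; exact: nbhs_infty_ger.
Unshelve. all: by end_near. Qed.

Let cvg_C : C @ \oo --> (1 : R).
Proof.
rewrite -expR0; apply: continuous_cvg; first exact: continuous_expR.
rewrite -(mulr0 ((L + 2^-1) ^+ 2 / 2)).
rewrite (_ : (fun n => _) = (fun n => ((L + 2^-1) ^+ 2 / 2) * n.+1%:R^-1)).
  by apply: cvgM; [exact: cvg_cst|exact: cvg_harmonic].
by apply/funext => n; rewrite invfM mulrA.
Qed.

(* The density has mean 1 and is uniformly bounded by [C n], which tends to 1: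
   so it tends to 1 at every atom. *)
Lemma cvg_binomial_ratio k : 0 < poisson_weight L k ->
  (fun n => binomial_ratio n.+1 k) @ \oo --> (1 : R).
Proof.
move=> pk; have lim : (fun n => C n - (C n - 1) / poisson_weight L k) @ \oo --> (1 : R).
  rewrite -[X in _ --> X](subr0 1) -(mul0r (poisson_weight L k)^-1) -(subrr 1).
  apply: cvgB => //; apply: cvgM; last exact: cvg_cst.
  by apply: cvgB => //; exact: cvg_cst.
apply: (squeeze_cvgr _ lim cvg_C); near=> n.
have Ln : L <= n.+1%:R by near: n; exact: near_ge_nat.
have kn : (k < n.+2)%N by near: n; exists k => // m /= km; rewrite ltnS leqW.
apply/andP; split; last exact: binomial_ratio_le.
rewrite lerBlDr -lerBlDl ler_pdivlMr//.
(* The deficits below [C n] are non-negative and their Poisson mean is at most [C n - 1], so the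
   single deficit at [k] is at most [(C n - 1) / poisson_weight L k]. *)
have : \sum_(i < n.+2) (C n - binomial_ratio n.+1 i) * poisson_weight L i <= C n - 1.
  under eq_bigr do rewrite mulrBl.
  rewrite sumrB sum_binomial_ratio// lerB// -mulr_sumr.
  by rewrite ler_piMr ?expR_ge0// poisson_weight_partial_sum.
apply: le_trans; rewrite (bigD1 (Ordinal kn))//= lerDl.
apply: sumr_ge0 => i _; rewrite mulr_ge0 ?poisson_weight_ge0//.
by rewrite subr_ge0 binomial_ratio_le.
Unshelve. all: by end_near. Qed.

Variable a : nat -> R.
Hypothesis a_ge0 : forall k, 0 <= a k.
Hypothesis a_eq0 : forall k, poisson_weight L k = 0 -> a k = 0.

Let t n := \sum_(i < n.+2) binomial_ratio n.+1 i * a i.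

Let cvg_term k : (fun n => binomial_ratio n.+1 k * a k) @ \oo --> a k.
Proof.
have := poisson_weight_ge0 k L_ge0; rewrite le_eqVlt => /predU1P[/esym p0|p0].
  rewrite a_eq0//; under eq_fun do rewrite mulr0; exact: cvg_cst.
by rewrite -[X in _ --> X]mul1r; apply: cvgM; [exact: cvg_binomial_ratio|exact: cvg_cst].
Qed.

Let cvg_partial K : (fun n => \sum_(i < K) binomial_ratio n.+1 i * a i) @ \oo
  --> \sum_(i < K) a i.
Proof.
elim: K => [|K ih].
  by under eq_fun do rewrite big_ord0; rewrite big_ord0; exact: cvg_cst.
under eq_fun do rewrite big_ord_recr/=; rewrite big_ord_recr/=.
by apply: cvgD => //; exact: cvg_term.
Qed.

Let partial_le K : \forall n \near \oo,
  \sum_(i < K) binomial_ratio n.+1 i * a i <= t n.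
Proof.
near=> n; have Ln : L <= n.+1%:R by near: n; exact: near_ge_nat.
have Kn : (K <= n.+2)%N by near: n; exists K => // m /= Km; rewrite !leqW.
rewrite /t -!(big_mkord xpredT (fun i => binomial_ratio n.+1 i * a i)).
rewrite [leRHS](big_cat_nat (leq0n K) Kn)//= lerDl; apply: sumr_ge0 => i _.
by rewrite mulr_ge0// binomial_ratio_ge0.
Unshelve. all: by end_near. Qed.

(** A Fatou-type bound: finite partial sums converge and are eventually below [t n], so summability
    of [a] can be a consequence instead of an assumption. *)
Lemma binomial_mix_ge (b : nat -> R) (beta : R) K : b @ \oo --> beta ->
  (\forall n \near \oo, t n <= b n) -> \sum_(i < K) a i <= beta.
Proof.
move=> bb tb; apply: (ler_cvg_to (@cvg_partial K) bb); near=> n.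
apply: (@le_trans _ _ (t n)); near: n => //; exact: partial_le.
Unshelve. all: by end_near. Qed.

(** Dominated convergence by hand: [t n] lies between a partial sum, which converges termwise, and
    [C n * A]. *)
Lemma cvg_binomial_mix (A : R) : series a @ \oo --> A -> t @ \oo --> A.
Proof.
move=> aA; have aleA n : \sum_(i < n) a i <= A.
  rewrite -(cvg_lim _ aA)// -(big_mkord xpredT a).
  apply: nondecreasing_cvgn_le; last exact: cvgP aA.
  by apply/nondecreasing_seqP => m; rewrite /series/= big_nat_recr//= lerDl.
have CA : (fun n => C n * A) @ \oo --> A.
  by rewrite -[X in _ --> X]mul1r; apply: cvgM => //; exact: cvg_cst.
apply/cvgrPdist_le => e e0.
have e20 : 0 < e / 2 by rewrite divr_gt0.
have /cvgrPdist_le/(_ _ e20)[K _ /(_ K (leqnn _))] := aA.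
rewrite /series/= big_mkord => AK.
have /cvgrPdist_le/(_ _ e20) h1 := @cvg_partial K.
have /cvgrPdist_le/(_ _ e0) h2 := CA.
near=> n.
have Ln : L <= n.+1%:R by near: n; exact: near_ge_nat.
have tC : t n <= C n * A.
  apply: (@le_trans _ _ (C n * \sum_(i < n.+2) a i)).
    rewrite mulr_sumr; apply: ler_sum => i _.
    by rewrite ler_wpM2r// binomial_ratio_le.
  by rewrite ler_wpM2l ?expR_ge0.
have pt : \sum_(i < K) binomial_ratio n.+1 i * a i <= t n.
  by near: n; exact: partial_le.
have h1' : `|\sum_(i < K) a i - \sum_(i < K) binomial_ratio n.+1 i * a i| <= e / 2.
  by near: n; exact: h1.
have h2' : `|A - C n * A| <= e by near: n; exact: h2.
move: AK h1' h2' tC pt; rewrite !ler_norml => /andP[? ?] /andP[? ?] /andP[? ?] ? ?.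
by apply/andP; split; lra.
Unshelve. all: by end_near. Qed.

End binomial_over_poisson.

(** * Means of functions with values in an interval *)

Section mean_in_interval.
Local Open Scope ereal_scope.
Context d (T : measurableType d) (R : realType) (m : {measure set T -> \bar R}).
Variables (D : set T).
Hypotheses (mD : measurable D) (D0 : 0 < m D) (Doo : m D < +oo).

Let mDE : m D = (fine (m D))%:E.
Proof. by rewrite fineK// ge0_fin_numE. Qed.

Let mean (g : T -> R) := (fine (\int[m]_(x in D) (g x)%:E) / fine (m D))%R.

(** Equality or less would force [g = c] almost everywhere on [D], against [D] having positive
    measure. *)
Lemma lt_mean (g : T -> R) (c : R) : m.-integrable D (EFin \o g) ->
  (forall x, D x -> c < g x)%R -> (c < mean g)%R.
Proof.
move=> ig cg; have mD0 : (0 < fine (m D))%R by rewrite -lte_fin -mDE.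
have ic : m.-integrable D (EFin \o cst c).
  apply/integrableP; split; first exact: (measurable_cst c%:E).
  apply: (@le_lt_trans _ _ (`|c%:E| * m D)); last by rewrite mDE -EFinM ltry.
  by rewrite -(integral_cst m mD `|c%:E|).
have iB : m.-integrable D (fun x => (g x)%:E - c%:E) by exact: integrableB.
have IE : \int[m]_(x in D) ((g x)%:E - c%:E) =
    (fine (\int[m]_(x in D) (g x)%:E) - c * fine (m D))%:E.
  rewrite (integralB_EFin mD ig ic)/= (integral_cst m mD c%:E) EFinB EFinM -mDE.
  by rewrite fineK//; exact: integrable_fin_num.
rewrite ltNge ler_pdivrMr//; apply/negP => H.
have I0 : \int[m]_(x in D) `|(g x)%:E - c%:E| = 0.
  apply/eqP; rewrite eq_le integral_ge0// andbT.
  have -> : \int[m]_(x in D) `|(g x)%:E - c%:E| = \int[m]_(x in D) ((g x)%:E - c%:E).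
    apply: eq_integral => x /[!inE] Dx; rewrite gee0_abs//.
    by rewrite -EFinB lee_fin subr_ge0 ltW// cg.
  by rewrite IE lee_fin subr_le0.
have [N [mN N0 DN]] : ae_eq m D (fun x => (g x)%:E - c%:E) (cst 0).
  by apply/ae_eq_integral_abs => //; case/integrableP : iB.
have : m D <= m N.
  apply: le_measure; rewrite ?inE// => x Dx; apply: DN => /= /(_ Dx) /eqP.
  by rewrite -EFinB eqe subr_eq0 gt_eqF// cg.
by rewrite N0 leNgt D0.
Qed.

(** If the mean is outside [I], then [I] lies strictly on one side of it, so the mean would be
    strictly above or below itself by [lt_mean], applied to [g] or to [- g]. *)
Lemma mean_in (I : set R) (g : T -> R) : is_interval I ->
  m.-integrable D (EFin \o g) -> (forall x, D x -> I (g x)) -> I (mean g).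
Proof.
move=> Iitv ig Ig; apply: contrapT => nI.
have [x0 Dx0] : exists x0, D x0.
  apply: contrapT => nD; move: D0; rewrite (_ : D = set0) ?measure0 ?ltxx//.
  by rewrite -subset0 => x Dx; apply: nD; exists x.
have ne x : D x -> g x != mean g.
  by move=> Dx; apply/eqP => gx; apply: nI; rewrite -gx; exact: Ig.
have [gt|le] := ltP (mean g) (g x0).
  have : (mean g < mean g)%R.
    apply: lt_mean => // x Dx; rewrite lt_neqAle eq_sym ne//= leNgt.
    apply/negP => lx; apply: nI; apply: (Iitv (g x) (g x0)); rewrite ?(ltW lx) ?(ltW gt)//; exact: Ig.
  by rewrite ltxx.
have meanN : mean (\- g)%R = (- mean g)%R.
  rewrite /mean (_ : \int[m]_(x in D) _ = - \int[m]_(x in D) (g x)%:E).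
    by rewrite fineN mulNr.
  rewrite -integralN//; exact: integrable_add_def.
have : (- mean g < mean (\- g))%R.
  apply: lt_mean => [|x Dx].
    rewrite (_ : _ \o _ = -%E \o (EFin \o g)); last by [].
    exact: integrableN.
  rewrite ltrN2 lt_neqAle ne//= leNgt.
  apply/negP => lx; apply: nI; apply: (Iitv (g x0) (g x)); rewrite ?(ltW lx) ?le//; exact: Ig.
by rewrite meanN ltxx.
Qed.

End mean_in_interval.

Lemma mean_in_probability d (T : measurableType d) (R : realType)
    (P : probability T R) (I : set R) (g : T -> R) : is_interval I ->
  P.-integrable setT (EFin \o g) -> (forall w, I (g w)) ->
  I (fine (\int[P]_w (g w)%:E)%E).
Proof.
move=> Iitv ig Ig.
have P0 : (0 < P setT)%E by rewrite probability_setT lte01.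
have Poo : (P setT < +oo)%E by rewrite probability_setT ltry.
set m := fine _; have <- : m / fine (P setT) = m.
  by rewrite probability_setT divr1.
exact: (mean_in measurableT P0 Poo Iitv ig).
Qed.

Lemma cvg_comp_within (R : realType) (I : set R) (f : R -> R) (u : nat -> R) (c : R) :
  {within I, continuous f} -> I c -> (forall n, I (u n)) -> u @ \oo --> c ->
  (fun n => f (u n)) @ \oo --> f c.
Proof.
move=> /subspace_continuousP cf Ic Iu uc.
apply: cvg_comp; last exact: cf c Ic.
move=> A nA; have h : \forall n \near \oo, I (u n) -> A (u n) := uc _ nA.
suff : \forall n \near \oo, A (u n) by [].
by apply: filterS h => n; apply.
Qed.

(** * Splitting the law of the counts by the total number of points *)

Section levels.
Local Open Scope ereal_scope.
Context d (X : measurableType d) (R : realType).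
Local Notation Omega := (pointMeasure X R).
Variables (mu : {sigma_finite_measure set X -> \bar R}) (P : probability Omega R).
Hypothesis P_poisson : is_poisson_law mu P.
Context (K : finType) (c : X -> option K).
Hypothesis cc : coloring mu c.
Local Notation S := {ffun K -> option nat}.
Implicit Types (f h : S -> R) (s : S).

Let mc k : measurable (color c k). Proof. by have [] := cc k. Qed.

Let lam := intensity mu c.
Let L := (\sum_k lam k)%R.

Let lam_ge0 k : (0 <= lam k)%R. Proof. exact: intensity_ge0. Qed.
Let L_ge0 : (0 <= L)%R. Proof. exact: sumr_ge0. Qed.

Definition colored := \bigcup_k color c k.

Lemma coloredE x : colored x <-> c x != None.
Proof.
split; first by move=> [k _]; rewrite /color/= => ->.
by case cx : (c x) => [k|]// _; exists k.
Qed.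

Lemma measurable_colored : measurable colored.
Proof. by apply: fin_bigcup_measurable => // ; exact: finite_finset. Qed.

Let trivIset_color : trivIset setT (color c).
Proof. by move=> i j _ _ [x []]; rewrite /color/= => -> []. Qed.

Lemma measure_colored (m : {measure set X -> \bar R}) :
  m colored = \sum_k m (color c k).
Proof. by rewrite /colored measure_bigcup_finType. Qed.

Lemma mu_colored : mu colored = L%:E.
Proof.
rewrite measure_colored /L -sumEFin; apply: eq_bigr => k _.
exact: intensityE cc k.
Qed.

Lemma measurable_counts_fun f : measurable_fun setT (fun w : Omega => (f (counts c w))%:E).
Proof.
apply/measurable_EFinP => _ V mV; rewrite setTI.
exact: (measurable_counts_preimage (f @^-1` V)).
Qed.

Lemma integral_coloring (a : K -> R) : (forall k, 0 <= a k)%R ->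
  \int[mu]_x (if c x is Some k then a k else 0%R)%:E =
  (\sum_k lam k * a k)%:E.
Proof.
move=> a0.
have E x : (if c x is Some k then a k else 0%R)%:E =
    \sum_k (a k)%:E * (\1_(color c k) x)%:E :> \bar R.
  case cx : (c x) => [k|].
    rewrite (bigD1 k)//= big1 => [|j jk].
      by rewrite indicE mem_set// mule1 adde0.
    rewrite indicE memNset ?mule0// /color/= cx => -[] /eqP.
    by rewrite eq_sym (negbTE jk).
  rewrite big1// => k _; rewrite indicE memNset ?mule0//.
  by rewrite /color/= cx.
under eq_integral do rewrite E.
rewrite ge0_integral_sum//.
- rewrite -sumEFin; apply: eq_bigr => k _; rewrite ge0_integralZl_EFin//.
    rewrite mulrC EFinM integral_indic// setIT; congr (_ * _).
    exact: intensityE cc k.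
  by apply/measurable_EFinP; exact: measurable_indic.
- move=> k; apply: emeasurable_funM => //.
  by apply/measurable_EFinP; exact: measurable_indic.
- by move=> k x _; rewrite mule_ge0// lee_fin.
Qed.

Definition zero_counts : S := [ffun=> Some 0%N].

Lemma hits0E (w : Omega) : hits colored 0 w <-> counts c w = zero_counts.
Proof.
rewrite countsE// /hits/=; split => [w0 k|w0].
  rewrite ffunE/=; apply/eqP; rewrite eq_le measure_ge0 andbT.
  rewrite -w0; apply: le_measure; rewrite ?inE//; first exact: measurable_colored.
  by move=> x kx; exists k.
by rewrite measure_colored big1// => k _; rewrite w0 ffunE.
Qed.

Lemma hits_addE (w : Omega) x n : (hits colored n.+1 (add_point w x) /\ colored x) <->
  (hits colored n w /\ colored x).
Proof.
have mC := measurable_colored.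
rewrite /hits/= add_pointE; split => -[wn Cx]; split => //; move: wn.
  rewrite diracE mem_set//; have [->//|[k ->]] := point_measure_nat w mC.
  by rewrite -EFinD natr1 => -[/eqP]; rewrite eqr_nat eqSS => /eqP ->.
by move=> ->; rewrite diracE mem_set// -EFinD natr1.
Qed.

(** Mecke's formula on the union of all cells: integrating over the added point produces exactly
    [raise]. *)
Lemma integral_hitsS f n : (forall s, 0 <= f s)%R ->
  n.+1%:R%:E * \int[P]_(w in hits colored n.+1) (f (counts c w))%:E =
  \int[P]_(w in hits colored n) (raise lam (@incr K) f (counts c w))%:E.
Proof.
move=> f0; have mC := measurable_colored.
have Coo : mu colored < +oo by rewrite mu_colored ltry.
have mg := measurable_counts_fun f.
rewrite -(mecke_integral P_poisson n.+1 mC Coo mg)//; last first.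
  by move=> w; rewrite lee_fin.
have mH : measurable (hits_after_adding colored n.+1 : set (Omega * X)).
  exact: measurable_hits_after_adding.
pose g (p : Omega * X) := (f (counts c (add_point p.1 p.2)))%:E.
have mgadd : measurable_fun setT g.
  exact: (measurableT_comp mg (@measurable_add_point _ X R)).
have mgH : measurable_fun setT (g \_ @hits_after_adding d X R colored n.+1).
  by apply: (measurable_restrictT g mH).1; exact: measurable_funTS mgadd.
have gH0 p : 0 <= (g \_ @hits_after_adding d X R colored n.+1) p.
  by apply: erestrict_ge0 => *; rewrite lee_fin.
rewrite integral_mkcond (fubini_tonelli1 _ mgH gH0).
rewrite [RHS]integral_mkcond; apply: eq_integral => w _.
rewrite /fubini_F patchE; case: ifPn => [/set_mem wn|/negP wn].
  rewrite -integral_coloring//; apply: eq_integral => x _; rewrite patchE.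
  case: ifPn => [/set_mem /hits_addE [_ /coloredE]|/negP nx].
    by rewrite /g/= counts_add_point//; case: (c x).
  case cx : (c x) => [k|]//; exfalso; apply: nx; apply/mem_set/hits_addE.
  by split=> //; apply/coloredE; rewrite cx.
rewrite integral0_eq// => x _; rewrite patchE; case: ifPn => // /set_mem.
by move=> /hits_addE[wn' _]; exfalso; apply: wn; exact: mem_set.
Qed.

Lemma probability_hits n : P (hits colored n) = (poisson_weight L n)%:E.
Proof.
have -> : L = fine (mu colored) by rewrite mu_colored.
apply: (poisson_finite_count P_poisson n measurable_colored).
by rewrite mu_colored ltry.
Qed.

(** The contribution to the Poisson mean of [f] from configurations with [k] colored points: [k]
    points are placed one after the other from the empty state, and [k!] removes their order. *)
Definition level f k : R :=
  (expR (- L) / k`!%:R * iter k (raise lam (@incr K)) f zero_counts)%R.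

Lemma level_ge0 f k : (forall s, 0 <= f s)%R -> (0 <= level f k)%R.
Proof.
by move=> f0; rewrite mulr_ge0 ?divr_ge0 ?expR_ge0 ?iter_raise_ge0.
Qed.

Lemma integral_hits f k : (forall s, 0 <= f s)%R ->
  \int[P]_(w in hits colored k) (f (counts c w))%:E = (level f k)%:E.
Proof.
have mC := measurable_colored.
have Coo : mu colored < +oo by rewrite mu_colored ltry.
elim: k f => [|k ih] f f0.
  rewrite (eq_integral (cst (f zero_counts)%:E)); last first.
    by move=> w /[!inE] /hits0E ->.
  rewrite integral_cst; last exact: measurable_hits.
  rewrite [X in _ * X]probability_hits -EFinM /level /poisson_weight/=.
  by rewrite expr0 fact0 !mulr1 mulrC.
have rf0 s : (0 <= raise lam (@incr K) f s)%R.
  by apply: sumr_ge0 => j _; rewrite mulr_ge0.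
have := integral_hitsS k f0; rewrite ih//.
move/(congr1 (fun y => k.+1%:R^-1%:E * y)).
rewrite muleA -EFinM mulVf ?pnatr_eq0// mul1e => ->.
rewrite -EFinM; congr EFin; rewrite /level iterSr factS natrM invfM.
by ring.
Qed.

Lemma level_eq0 f k : (forall s, 0 <= f s)%R -> poisson_weight L k = 0%R ->
  level f k = 0%R.
Proof.
move=> f0 p0; apply: EFin_inj; rewrite -integral_hits//.
have mC := measurable_colored.
have Coo : mu colored < +oo by rewrite mu_colored ltry.
rewrite null_set_integral//.
- exact: measurable_hits.
- exact: measurable_funTS (measurable_counts_fun f).
- by rewrite [LHS]probability_hits p0.
Qed.

Lemma integral_counts f : (forall s, 0 <= f s)%R ->
  \int[P]_w (f (counts c w))%:E = \sum_(k <oo) (level f k)%:E.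
Proof.
move=> f0; have mC := measurable_colored.
have Coo : mu colored < +oo by rewrite mu_colored ltry.
pose N := [set w : Omega | w colored = +oo].
have mN : measurable N.
  rewrite -[N]setTI; exact: (measurable_eval mC measurableT (emeasurable_set1 _)).
have mg := measurable_counts_fun f.
rewrite (@ge0_negligible_integral _ _ _ _ setT N)//; last 2 first.
- by move=> w _; rewrite lee_fin.
- exact: (poisson_infinite_count P_poisson mC Coo).
have -> : setT `\` N = \bigcup_k hits colored k.
  apply/seteqP; split => w; last by move=> [k _]; rewrite /hits/= => wk; split=> //; rewrite /N/= wk.
  move=> [_]; rewrite /N/=; have [->//|[k wk] _] := point_measure_nat w mC.
  by exists k.
rewrite ge0_integral_bigcup//.
- by apply: eq_eseriesr => k _; rewrite integral_hits.
- by move=> k; exact: measurable_hits.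
- exact: measurable_funTS.
- by move=> w _; rewrite lee_fin.
- by move=> i j _ _ [w []]; rewrite /hits/= => -> [/eqP]; rewrite eqr_nat => /eqP.
Qed.

(** The Poisson mean is the plain sum of the same levels by [integral_counts], so chain and Poisson
    law differ only by the density of the total number of points. *)
Lemma iter_birth_level f n :
  iter n (birth lam (@incr K) n%:R^-1) f zero_counts =
  (\sum_(i < n.+1) binomial_ratio L n i * level f i)%R.
Proof.
rewrite iter_birthE; apply: eq_bigr => i _.
rewrite /birth_weight /binomial_ratio /level -/L expRN.
field; rewrite ?pnatr_eq0 -?lt0n ?fact_gt0 ?gt_eqF ?expR_gt0//.
Qed.

Lemma cvg_iter_birth f (A : R) : (forall s, 0 <= f s)%R ->
  \int[P]_w (f (counts c w))%:E = A%:E ->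
  (fun n => iter n.+1 (birth lam (@incr K) n.+1%:R^-1) f zero_counts) @ \oo --> A.
Proof.
move=> f0 fA; under eq_fun do rewrite iter_birth_level.
apply: cvg_binomial_mix => //.
- by move=> k; exact: level_ge0.
- by move=> k; exact: level_eq0.
have : (fun n => \sum_(0 <= k < n) (level f k)%:E) @ \oo --> A%:E.
  rewrite -fA integral_counts//; apply: is_cvg_nneseries => k _ _.
  by rewrite lee_fin level_ge0.
move/fine_cvg; rewrite (_ : fine \o _ = series (level f))//.
by apply/funext => n /=; rewrite sumEFin.
Qed.

End levels.

(** * The entropy inequality for functions of the counts *)

Section counts_entropy.
Local Open Scope ereal_scope.
Context (R : realType) (I : set R) (Phi : R -> R).
Hypothesis Iitv : is_interval I.
Hypothesis Phi_smooth : smooth_in I Phi.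
Hypothesis Psi_ge0 : forall u v, I u -> I (u + v)%R -> (0 <= Psi I Phi u v)%R.
Hypothesis Psi_convex : convex_function (Psi_domain I)
                  (fun p => Psi I Phi p.1 p.2).
Context d (X : measurableType d).
Local Notation Omega := (pointMeasure X R).
Variables (mu : {sigma_finite_measure set X -> \bar R}) (P : probability Omega R).
Hypothesis P_poisson : is_poisson_law mu P.
Context (K : finType) (c : X -> option K).
Hypothesis cc : coloring mu c.
Local Notation S := {ffun K -> option nat}.
Local Notation lam := (intensity mu c).
Local Notation L := (\sum_k lam k)%R.
Local Notation s0 := (zero_counts K).
Local Notation prod_ := (production lam (@incr K) I Phi).

Let lam_ge0 k : (0 <= lam k)%R. Proof. exact: intensity_ge0. Qed.
Let L_ge0 : (0 <= L)%R. Proof. exact: sumr_ge0. Qed.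

Let T n := birth lam (@incr K) n.+1%:R^-1.

Let e_ge0 n : (0 <= n.+1%:R^-1 :> R)%R. Proof. by rewrite invr_ge0. Qed.

Let eL_le1 n : (L <= n.+1%:R -> n.+1%:R^-1 * L <= 1)%R.
Proof. by move=> Ln; rewrite mulrC ler_pdivrMr ?ltr0n// mul1r. Qed.

Lemma cvg_iter_birth_mean (h : S -> R) :
  P.-integrable setT (fun w : Omega => (h (counts c w))%:E) ->
  (fun n => iter n.+1 (T n) h s0) @ \oo -->
  fine (\int[P]_w (h (counts c w))%:E).
Proof.
move=> ih; pose f s := Num.max (h s) 0%R; pose g s := Num.max (- h s)%R 0%R.
have f0 s : (0 <= f s)%R by rewrite le_max lexx orbT.
have g0 s : (0 <= g s)%R by rewrite le_max lexx orbT.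
have fP : (fun w : Omega => (f (counts c w))%:E) = (fun w : Omega => (h (counts c w))%:E)^\+.
  by apply/funext => w; rewrite funeposE EFin_max.
have gP : (fun w : Omega => (g (counts c w))%:E) = (fun w : Omega => (h (counts c w))%:E)^\-.
  by apply/funext => w; rewrite funenegE EFin_max EFinN.
have fi : P.-integrable setT (fun w : Omega => (f (counts c w))%:E).
  by rewrite fP; exact: integrable_funepos.
have gi : P.-integrable setT (fun w : Omega => (g (counts c w))%:E).
  by rewrite gP; exact: integrable_funeneg.
have fE : \int[P]_w (f (counts c w))%:E = (fine (\int[P]_w (f (counts c w))%:E))%:E.
  by rewrite fineK//; exact: integrable_fin_num.
have gE : \int[P]_w (g (counts c w))%:E = (fine (\int[P]_w (g (counts c w))%:E))%:E.
  by rewrite fineK//; exact: integrable_fin_num.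
have -> : fine (\int[P]_w (h (counts c w))%:E) =
    (fine (\int[P]_w (f (counts c w))%:E) - fine (\int[P]_w (g (counts c w))%:E))%R.
  by rewrite [X in fine X = _]integralE -fP -gP fE gE.
have hE n : iter n.+1 (T n) h s0 =
    (iter n.+1 (T n) f s0 - iter n.+1 (T n) g s0)%R.
  transitivity (iter n.+1 (T n) (fun t => 0 + 1 * f t + -1 * g t)%R s0).
    congr (iter _ _ _ _); apply/funext => s; rewrite /f /g.
    by case: (leP (h s) 0%R) => h1; case: (leP (- h s)%R 0%R) => h2; lra.
  by rewrite /T iter_birth_affine add0r mul1r mulN1r.
under eq_fun do rewrite hE.
by apply: cvgB; [exact: (cvg_iter_birth P_poisson cc f0 fE)|exact: (cvg_iter_birth P_poisson cc g0 gE)].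
Qed.

Lemma counts_entropy (h : S -> R) : (forall s, I (h s)) ->
  P.-integrable setT (fun w : Omega => (h (counts c w))%:E) ->
  \int[P]_w (Bregman I Phi (fine (\int[P]_w (h (counts c w))%:E)) (h (counts c w)))%:E
  <= \int[P]_w (prod_ h (counts c w))%:E.
Proof.
move=> Ih ih; set c0 := fine _.
have Ic0 : I c0 by exact: (mean_in_probability Iitv ih).
have q0 s : (0 <= Bregman I Phi c0 (h s))%R by exact: Bregman_ge0.
have G0 s : (0 <= prod_ h s)%R by exact: production_ge0.
have [->|Gfin] := eqVneq (\int[P]_w (prod_ h (counts c w))%:E) +oo.
  by rewrite leey.
set A := fine (\int[P]_w (prod_ h (counts c w))%:E).
have AE : \int[P]_w (prod_ h (counts c w))%:E = A%:E.
  rewrite fineK// ge0_fin_numE ?ltey//.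
  by apply: integral_ge0 => w _; rewrite lee_fin.
rewrite AE; pose cn n := iter n.+1 (T n) h s0.
have cnc : cn @ \oo --> c0 by exact: cvg_iter_birth_mean.
(* An upper bound for the chain with limit [A]: its first term vanishes because [cn n] tends to
   [c0], and the factor of the second one pays for having [n.+1] iterates instead of [n]. *)
pose b n := (Bregman I Phi c0 (cn n) +
   (1 - n.+1%:R^-1 * L)^-1 * iter n.+1 (T n) (prod_ h) s0)%R.
have Icn : \forall n \near \oo, I (cn n).
  near=> n; have Ln : (L <= n.+1%:R)%R by near: n; exact: near_ge_nat.
  have eL := eL_le1 Ln.
  have : forall m s, I (iter m (T n) h s).
    by elim=> //= m ihm s; exact: birth_in.
  exact.
have bA : b @ \oo --> (0 + 1^-1 * A)%R.
  apply: cvgD; last first.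
    apply: cvgM; last exact: (cvg_iter_birth P_poisson cc G0 AE).
    apply: cvgV; first exact: oner_neq0.
    have lim : (fun n => 1 - n.+1%:R^-1 * L)%R @ \oo --> (1 - 0 * L)%R.
      apply: cvgB; first exact: cvg_cst.
      by apply: cvgM; [exact: cvg_harmonic|exact: cvg_cst].
    by rewrite mul0r subr0 in lim.
  (* [cn n] belongs to [I] only for large [n], when the steps are Markov, whereas continuity within
     [I] is used along a sequence lying entirely in [I]. *)
  pose cn' n := if pselect (I (cn n)) then cn n else c0.
  have cn'E : \forall n \near \oo, cn' n = cn n.
    by apply: filterS Icn => n In; rewrite /cn'; case: pselect.
  have cn'c : cn' @ \oo --> c0.
    by apply: cvg_trans cnc; apply: near_eq_cvg; apply: filterS cn'E => n ->.
  have Icn' n : I (cn' n) by rewrite /cn'; case: pselect.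
  have lim : (fun n => Phi (cn' n) - Phi c0 - derive_in I Phi c0 * (cn' n - c0))%R @ \oo
     --> (Phi c0 - Phi c0 - derive_in I Phi c0 * (c0 - c0))%R.
    apply: cvgB.
      apply: cvgB; last exact: cvg_cst.
      exact: (cvg_comp_within (continuous_Phi Phi_smooth) Ic0 Icn' cn'c).
    apply: cvgM; first exact: cvg_cst.
    by apply: cvgB => //; exact: cvg_cst.
  rewrite subrr subrr mulr0 subr0 in lim.
  apply: cvg_trans lim; apply: near_eq_cvg.
  by apply: filterS cn'E => n ->; rewrite BregmanE.
rewrite add0r invr1 mul1r in bA.
rewrite (integral_counts P_poisson cc (f := fun s => Bregman I Phi c0 (h s)))//.
apply: lime_le; first by apply: is_cvg_nneseries => k _ _; rewrite lee_fin level_ge0.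
near=> m; rewrite sumEFin lee_fin big_mkord.
apply: (binomial_mix_ge (L := L)) bA _ => //.
- by move=> k; exact: level_ge0.
- by move=> k; exact: (level_eq0 P_poisson cc).
(* The extra 1 makes [1 - L / n.+1] positive and hence invertible, even when [L = 0]. *)
near=> n; have Ln : (L + 1 <= n.+1%:R)%R by near: n; exact: near_ge_nat.
have Ln' : (L <= n.+1%:R)%R by apply: le_trans Ln; rewrite lerDl.
have eL := eL_le1 Ln'.
have eL0 : (0 < 1 - n.+1%:R^-1 * L)%R.
  rewrite subr_gt0 mulrC ltr_pdivrMr ?ltr0n// mul1r.
  by apply: lt_le_trans Ln; rewrite ltrDl.
rewrite -iter_birth_level -/(T n) /b.
have BE : iter n.+1 (T n) (fun s => Bregman I Phi c0 (h s)) s0 =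
    (iter n.+1 (T n) (Phi \o h) s0 - Phi c0 - derive_in I Phi c0 * (cn n - c0))%R.
  have -> : (fun s => Bregman I Phi c0 (h s)) = (fun s =>
      (- Phi c0 + derive_in I Phi c0 * c0) + 1 * (Phi \o h) s
      + (- derive_in I Phi c0) * h s)%R.
    by apply/funext => s; rewrite BregmanE/=; ring.
  by rewrite iter_birth_affine /cn /T; ring.
rewrite BE BregmanE.
have H1 := iter_birth_entropy lam_ge0 (@incrC K) Iitv Phi_smooth Psi_ge0 Psi_convex
   n s0 (e_ge0 n) eL Ih.
(* A step applied to a non-negative function keeps at least the part that does not jump. *)
have H2 : ((1 - n.+1%:R^-1 * L) * iter n (T n) (prod_ h) s0 <=
    iter n.+1 (T n) (prod_ h) s0)%R.
  rewrite iterS {2}/T /birth lerDl mulr_ge0//.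
  apply: sumr_ge0 => k _; rewrite mulr_ge0//.
  have : forall m s, (0 <= iter m (T n) (prod_ h) s)%R.
    elim=> //= j ihj s; rewrite addr_ge0// mulr_ge0// ?(ltW eL0)//.
    by apply: sumr_ge0 => i _; rewrite mulr_ge0.
  exact.
have {}H2 : (iter n (T n) (prod_ h) s0 <=
    (1 - n.+1%:R^-1 * L)^-1 * iter n.+1 (T n) (prod_ h) s0)%R.
  by rewrite ler_pdivlMl.
move: H1; rewrite -/(T n) mulfV ?pnatr_eq0// mul1r -/(cn n) => H1.
move: H1 H2; move: (iter n.+1 (T n) (Phi \o h) s0) (iter n (T n) (prod_ h) s0).
by move: ((_)^-1 * _)%R => x y z; move: (Phi c0) (Phi (cn n)) (_ * (_ - _))%R => *; lra.
Unshelve. all: by end_near. Qed.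

End counts_entropy.

(** * Conditioning on finitely many counts *)

Section scaled_transfer.
Local Open Scope ereal_scope.
Context (R : realType) d1 (T1 : measurableType d1) d2 (T2 : measurableType d2).
Variables (m1 : {measure set T1 -> \bar R}) (m2 : {measure set T2 -> \bar R}).
Variables (W : set T1) (D : set T2) (phi : T1 -> T2) (k : R).
Hypotheses (mW : measurable W) (mD : measurable D).
Hypotheses (mphi : measurable_fun setT phi) (k_gt0 : (0 < k)%R).
Hypothesis phiE : forall C, measurable C -> m1 (phi @^-1` C `&` W) = k%:E * m2 (C `&` D).

Lemma ge0_integral_scaled_transfer (f : T2 -> \bar R) :
  measurable_fun setT f -> (forall x, 0 <= f x) ->
  \int[m1]_(x in W) f (phi x) = k%:E * \int[m2]_(y in D) f y.
Proof.
move=> mf f0.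
rewrite (@ge0_integral_transfer _ _ _ _ _ _
  (mscale (NngNum (ltW k_gt0)) (mrestr m2 mD)) W phi)//.
by rewrite ge0_integral_mscale// ge0_integral_mrestr.
Qed.

Lemma measure_scaled_transfer : m1 W = k%:E * m2 D.
Proof. by rewrite -(setTI D) -phiE// preimage_setT setTI. Qed.

Variable g : T2 -> R.
Hypothesis mg : measurable_fun setT g.
Hypothesis ig : m2.-integrable D (EFin \o g).

Lemma integrable_scaled_transfer : m1.-integrable W (EFin \o (g \o phi)).
Proof.
apply/integrableP; split.
  by apply: measurable_funTS; apply/measurable_EFinP; exact: measurableT_comp.
rewrite (@ge0_integral_scaled_transfer (fun y => `|(g y)%:E|))//.
  by move/integrableP : ig => [_ h]; apply: lte_mul_pinfty => //; rewrite lee_fin ltW.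
by apply: measurableT_comp => //; exact/measurable_EFinP.
Qed.

Lemma integral_scaled_transfer :
  \int[m1]_(x in W) (g (phi x))%:E = k%:E * \int[m2]_(y in D) (g y)%:E.
Proof.
rewrite [LHS]integralE [in RHS]integralE.
have mgE : measurable_fun setT (EFin \o g) by exact/measurable_EFinP.
rewrite (_ : (fun x => (g (phi x))%:E)^\+ = (EFin \o g)^\+ \o phi); last first.
  by apply/funext => x; rewrite /= !funeposE.
rewrite (_ : (fun x => (g (phi x))%:E)^\- = (EFin \o g)^\- \o phi); last first.
  by apply/funext => x; rewrite /= !funenegE.
rewrite (ge0_integral_scaled_transfer (measurable_funepos mgE))//.
rewrite (ge0_integral_scaled_transfer (measurable_funeneg mgE))//.
have sub_mul (A B : \bar R) : B \is a fin_num -> k%:E * A - k%:E * B = k%:E * (A - B).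
  by move=> fB; rewrite muleBr// fin_num_adde_defl// fin_numN.
apply: sub_mul.
by apply: integrable_fin_num => //; exact: integrable_funeneg.
Qed.

(** The factor [k] cancels in a mean. This is applied to the projection [(w, x) -> w] with
    [k = lam k], and to [(w, x) -> w + delta_x] with [k = n.+1]. *)
Lemma mean_scaled_transfer :
  (fine (\int[m1]_(x in W) (g (phi x))%:E) / fine (m1 W) =
   fine (\int[m2]_(y in D) (g y)%:E) / fine (m2 D))%R.
Proof.
rewrite integral_scaled_transfer measure_scaled_transfer.
have kD : fine (k%:E * m2 D) = (k * fine (m2 D))%R.
  have [->|] := eqVneq (m2 D) +oo; first by rewrite gt0_muley ?lte_fin//= mulr0.
  by rewrite -ltey => h; rewrite fineM// ge0_fin_numE.
rewrite kD fineM//; last exact: integrable_fin_num.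
by rewrite /= -mulf_div divff ?mul1r ?gt_eqF.
Qed.

End scaled_transfer.

Section jensen.
Local Open Scope ereal_scope.
Context (R : realType) (I : set R) (Phi : R -> R).
Hypothesis Iitv : is_interval I.
Hypothesis Iclosed : closed I.
Hypothesis Phi_smooth : smooth_in I Phi.
Hypothesis Psi_ge0 : forall u v, I u -> I (u + v)%R -> (0 <= Psi I Phi u v)%R.
Hypothesis Psi_convex : convex_function (Psi_domain I)
                  (fun p => Psi I Phi p.1 p.2).
Context d (T : measurableType d).
Implicit Types f g : T -> R.

Lemma measurable_fun_in (F : R -> R) f : {within I, continuous F} ->
  measurable_fun setT f -> (forall x, I (f x)) -> measurable_fun setT (F \o f).
Proof.
move=> cF mf If; apply: (measurable_comp (F := I)) => //.
- exact: closed_measurable.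
- by move=> _ [x _ <-].
- apply: subspace_continuous_measurable_fun => //; exact: closed_measurable.
Qed.

Lemma measurable_Bregman f g : measurable_fun setT f -> measurable_fun setT g ->
  (forall x, I (f x)) -> (forall x, I (g x)) ->
  measurable_fun setT (fun x => Bregman I Phi (f x) (g x)).
Proof.
move=> mf mg If Ig; under eq_fun do rewrite BregmanE.
have mPf := measurable_fun_in (continuous_Phi Phi_smooth) mf If.
have mPg := measurable_fun_in (continuous_Phi Phi_smooth) mg Ig.
have mdf := measurable_fun_in (continuous_dPhi Phi_smooth) mf If.
apply: measurable_funB; first exact: measurable_funB.
by apply: measurable_funM => //; exact: measurable_funB.
Qed.

(** The tangent plane at the pair of means integrates over [D] to its value there times [m D]. If
    the right-hand side is infinite the claim is trivial; otherwise the divergence is integrable and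
    integrals can be compared. *)
Lemma Bregman_jensen (m : {measure set T -> \bar R}) (D : set T) f g :
  measurable D -> 0 < m D -> m D < +oo ->
  measurable_fun setT f -> measurable_fun setT g ->
  (forall x, I (f x)) -> (forall x, I (g x)) ->
  m.-integrable D (EFin \o f) -> m.-integrable D (EFin \o g) ->
  (Bregman I Phi (fine (\int[m]_(x in D) (f x)%:E) / fine (m D))
    (fine (\int[m]_(x in D) (g x)%:E) / fine (m D)))%:E * m D <=
  \int[m]_(x in D) (Bregman I Phi (f x) (g x))%:E.
Proof.
move=> mD D0 Doo mf mg If Ig intf intg.
set x0 := (_ / _)%R; set y0 := (_ / _)%R.
have Ix0 : I x0 by exact: mean_in.
have Iy0 : I y0 by exact: mean_in.
have mDE : m D = (fine (m D))%:E by rewrite fineK// ge0_fin_numE.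
have mD0 : fine (m D) != 0%R by rewrite gt_eqF// -lte_fin -mDE.
have mB := measurable_Bregman mf mg If Ig.
have B0 x : (0 <= Bregman I Phi (f x) (g x))%R by exact: Bregman_ge0.
have [->|Bfin] := eqVneq (\int[m]_(x in D) (Bregman I Phi (f x) (g x))%:E) +oo.
  by rewrite leey.
have iB : m.-integrable D (EFin \o (fun x => Bregman I Phi (f x) (g x))).
  apply/integrableP; split; first exact/measurable_funTS/measurable_EFinP.
  under eq_integral do rewrite /= ger0_norm//.
  by rewrite ltey.
set a := (- (derive_in I (derive_in I Phi) x0 * (y0 - x0)))%R.
set b := (derive_in I Phi y0 - derive_in I Phi x0)%R.
set q0 := Bregman I Phi x0 y0.
have ic (r : R) : m.-integrable D (cst r%:E).
  apply/integrableP; split; first exact: measurable_cst.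
  apply: (@le_lt_trans _ _ (`|r%:E| * m D)); last by rewrite mDE -EFinM ltry.
  by rewrite -(integral_cst m mD `|r%:E|).
have iaf : m.-integrable D (fun x => a%:E * (f x)%:E) by exact: integrableZl.
have ibg : m.-integrable D (fun x => b%:E * (g x)%:E) by exact: integrableZl.
have icaf : m.-integrable D (fun x => (q0 - a * x0 - b * y0)%:E + a%:E * (f x)%:E).
  exact: (integrableD mD (ic _) iaf).
have iall : m.-integrable D (fun x => (q0 - a * x0 - b * y0)%:E + a%:E * (f x)%:E
    + b%:E * (g x)%:E) by exact: (integrableD mD icaf ibg).
have fE : \int[m]_(x in D) (f x)%:E = (x0 * fine (m D))%:E.
  by rewrite /x0 divfK// fineK//; exact: integrable_fin_num.
have gE : \int[m]_(x in D) (g x)%:E = (y0 * fine (m D))%:E.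
  by rewrite /y0 divfK// fineK//; exact: integrable_fin_num.
have <- : \int[m]_(x in D) ((q0 - a * x0 - b * y0)%:E + a%:E * (f x)%:E
    + b%:E * (g x)%:E) = q0%:E * m D.
  rewrite (integralD mD icaf ibg) (integralD mD (ic _) iaf) !integralZl//.
  rewrite (integral_cst m mD) fE gE mDE -!EFinM -!EFinD; congr EFin.
  ring.
apply: le_integral => // x /[!inE] Dx; rewrite -!EFinM -!EFinD lee_fin.
have := @Bregman_support _ _ Iitv _ Phi_smooth Psi_convex x0 y0 (f x) (g x) Ix0 Iy0 (If _) (Ig _).
rewrite -/q0 -/b; apply: le_trans; rewrite le_eqVlt; apply/orP; left; apply/eqP.
by rewrite /a; ring.
Qed.

End jensen.

Section conditioning.
Local Open Scope ereal_scope.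
Context (R : realType) (I : set R) (Phi : R -> R).
Hypothesis Iitv : is_interval I.
Hypothesis Iclosed : closed I.
Hypothesis Phi_smooth : smooth_in I Phi.
Hypothesis Psi_ge0 : forall u v, I u -> I (u + v)%R -> (0 <= Psi I Phi u v)%R.
Hypothesis Psi_convex : convex_function (Psi_domain I)
                  (fun p => Psi I Phi p.1 p.2).
Context d (X : measurableType d).
Local Notation Omega := (pointMeasure X R).
Variables (mu : {sigma_finite_measure set X -> \bar R}) (P : probability Omega R).
Hypothesis P_poisson : is_poisson_law mu P.
Variable G : Omega -> R.
Hypotheses (mG : measurable_fun setT G) (iG : P.-integrable setT (EFin \o G)).
Hypothesis G_in : forall w, I (G w).
Context (K : finType) (c : X -> option K).
Hypothesis cc : coloring mu c.
Local Notation S := {ffun K -> option nat}.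
Local Notation lam := (intensity mu c).
Implicit Type s : S.

Let mc k : measurable (color c k). Proof. by have [] := cc k. Qed.

Let fiber s : set Omega := counts c @^-1` [set s].

Let mfiber s : measurable (fiber s). Proof. exact: measurable_counts. Qed.

Let fiberoo s : P (fiber s) < +oo.
Proof. by rewrite (le_lt_trans (probability_le1 _ (mfiber s)))// ltry. Qed.

Let iGfiber s : P.-integrable (fiber s) (EFin \o G).
Proof. exact: integrableS iG. Qed.

(* The value on a null fiber is irrelevant, but must stay in [I]. *)
Definition cond_mean s : R :=
  if P (fiber s) == 0 then G point
  else (fine (\int[P]_(w in fiber s) (G w)%:E) / fine (P (fiber s)))%R.

Let fiber_gt0 s : P (fiber s) != 0 -> 0 < P (fiber s).
Proof. by move=> h; rewrite lt_neqAle eq_sym h measure_ge0. Qed.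

Lemma cond_mean_in s : I (cond_mean s).
Proof.
rewrite /cond_mean; case: ifPn => // h.
exact: (mean_in (mfiber s) (fiber_gt0 h) (fiberoo s) Iitv (iGfiber s) (fun w _ => G_in w)).
Qed.

(** On each fiber [u (counts c w)] is constant, and the modulus of an integral is at most the
    integral of the modulus. Null fibers contribute nothing, whatever value [cond_mean] has
    there. *)
Lemma cond_mean_dist (u : S -> R) :
  \int[P]_w `|(cond_mean (counts c w))%:E - (u (counts c w))%:E| <=
  \int[P]_w `|(G w)%:E - (u (counts c w))%:E|.
Proof.
have mGu : measurable_fun setT (fun w => `|(G w)%:E - (u (counts c w))%:E|).
  apply: measurableT_comp => //; apply: emeasurable_funB.
    exact/measurable_EFinP.
  exact: (measurable_counts_fun cc u).
apply: (@le_integral_fibers _ _ _ _ _ (counts c)) => //.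
  exact: (measurable_counts_fun cc (fun s => `|cond_mean s - u s|%R)).
move=> s; have [Ps0|Ps0] := eqVneq (P (fiber s)) 0.
  rewrite [leLHS]null_set_integral//; first exact: integral_ge0.
    exact: mfiber.
  apply: measurable_funTS.
  exact: (measurable_counts_fun cc (fun s => `|cond_mean s - u s|%R)).
have iu : P.-integrable (fiber s) (cst (u s)%:E).
  apply/integrableP; split; first exact: measurable_cst.
  apply: (@le_lt_trans _ _ (`|(u s)%:E| * P (fiber s))).
    by rewrite -(integral_cst P (mfiber s) `|(u s)%:E|).
  by apply: lte_mul_pinfty.
have PE : P (fiber s) = (fine (P (fiber s)))%:E.
  by rewrite fineK// ge0_fin_numE.
have p0 : (0 < fine (P (fiber s)))%R by rewrite -lte_fin -PE fiber_gt0.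
rewrite (eq_integral (cst `|cond_mean s - u s|%:E)); last by move=> w /[!inE] /= ->.
rewrite integral_cst//.
have -> : `|cond_mean s - u s|%:E * P (fiber s) =
    `|\int[P]_(w in fiber s) ((G w)%:E - (u s)%:E)|.
  have -> : \int[P]_(w in fiber s) ((G w)%:E - (u s)%:E) =
      ((cond_mean s - u s) * fine (P (fiber s)))%:E.
    rewrite (integralB_EFin (mfiber s) (iGfiber s) iu) mulrBl EFinB.
    congr (_ - _).
      rewrite /cond_mean (negbTE Ps0) divfK ?gt_eqF// fineK//.
      exact: integrable_fin_num.
    by rewrite EFinM -PE; exact: (integral_cst P (mfiber s) (u s)%:E).
  by rewrite abse_EFin normrM (gtr0_norm p0) EFinM -PE.
apply: le_trans (le_abse_integral _ _ _) _ => //.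
  apply: emeasurable_funB; first exact/measurable_funTS/measurable_EFinP.
  exact: measurable_cst.
rewrite le_eqVlt; apply/orP; left; apply/eqP; apply: eq_integral => w.
by rewrite inE => /= ->.
exact: mfiber.
Qed.

Lemma integrable_cond_mean :
  P.-integrable setT (fun w => (cond_mean (counts c w))%:E).
Proof.
apply/integrableP; split; first exact: (measurable_counts_fun cc cond_mean).
have := cond_mean_dist (fun=> 0%R); under eq_integral do rewrite sube0.
under [X in _ <= X -> _]eq_integral do rewrite sube0.
by move=> h; apply: le_lt_trans h _; case/integrableP : iG.
Qed.

(* [u (counts c w)] is its own conditional mean, so conditioning at most doubles
   the distance to it. *)
Lemma cond_mean_dist2 (u : S -> R) :
  \int[P]_w `|(G w)%:E - (cond_mean (counts c w))%:E| <=
  2%:E * \int[P]_w `|(G w)%:E - (u (counts c w))%:E|.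
Proof.
have mGE : measurable_fun setT (EFin \o G) by exact/measurable_EFinP.
have mu_ := measurable_counts_fun cc u.
have mg := measurable_counts_fun cc cond_mean.
rewrite (_ : 2%:E = 1 + 1)// ge0_muleDl// mul1e.
apply: le_trans _ (leeD (lexx _) (cond_mean_dist u)).
rewrite -ge0_integralD//; last 2 first.
- by apply: measurableT_comp => //; exact: emeasurable_funB.
- by apply: measurableT_comp => //; exact: emeasurable_funB.
apply: ge0_le_integral => //.
- by apply: measurableT_comp => //; exact: emeasurable_funB.
- by apply: emeasurable_funD; apply: measurableT_comp => //; exact: emeasurable_funB.
- move=> w _; rewrite -!EFinB !abse_EFin -EFinD lee_fin.
  by rewrite (distrC (cond_mean _)) ler_distD.
Qed.

Let q (p : Omega * X) : \bar R :=
  (Bregman I Phi (G p.1) (G (add_point p.1 p.2)))%:E.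

Let mGadd : measurable_fun setT (fun p : Omega * X => G (add_point p.1 p.2)).
Proof. exact: (measurableT_comp mG (@measurable_add_point _ X R)). Qed.

Let mGfst : measurable_fun setT (fun p : Omega * X => G p.1).
Proof. exact: (measurableT_comp mG measurable_fst). Qed.

Lemma measurable_Bregman_add : measurable_fun setT q.
Proof. by apply/measurable_EFinP; exact: measurable_Bregman. Qed.

Let q_ge0 p : 0 <= q p.
Proof. by rewrite lee_fin; exact: Bregman_ge0. Qed.

Let cell s k : set (Omega * X) := fiber s `*` color c k.

Let cell_fst s k C : measurable C ->
  (P \x mu) (fst @^-1` C `&` cell s k) = (lam k)%:E * P (C `&` fiber s).
Proof.
move=> mC; rewrite (_ : _ `&` _ = (C `&` fiber s) `*` color c k); last first.
  by apply/seteqP; split => -[w x] /=; rewrite /cell/=; tauto.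
rewrite product_measure1E//; last exact: measurableI.
by rewrite muleC; congr (_ * _); exact: intensityE cc k.
Qed.

(** Mecke's formula for cell [k]: on the fiber of [incr k s] this cell holds [n.+1] points, so the
    localization to [hits] is automatic; injectivity of [incr] recovers [s]. *)
Let cell_add s k n C : s k = Some n -> measurable C ->
  (P \x mu) ((fun p => add_point p.1 p.2) @^-1` C `&` cell s k) =
  n.+1%:R%:E * P (C `&` fiber (incr k s)).
Proof.
move=> sk mC; have [mk fk] := cc k.
have mCf : measurable (C `&` fiber (incr k s)) by exact: measurableI.
have hk w : fiber (incr k s) w -> hits (color c k) n.+1 w.
  by move=> /(countsE w _ mc)/(_ k); rewrite /hits/= ffunE eqxx sk.
have := mecke_set P_poisson n.+1 mk fk mCf.
rewrite -setIA (setIidl hk) => <-; congr ((P \x mu) _).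
apply/seteqP; split => -[w x] /=.
  move=> [Cw [ws cx]].
  have ws' : counts c (add_point w x) = incr k s.
    by rewrite counts_add_point// cx ws.
  by do ! split => //; exact: hk.
move=> [[Cw ws'] [_ cx]]; split=> //; split=> //.
move: ws'; rewrite /fiber/= counts_add_point// (_ : c x = Some k)//.
exact: incr_inj.
Qed.

(** The left-hand side is rewritten as an integral over [Omega * X], constant on each cell. Jensen
    then applies cell by cell, the means being identified by the two transfers; uncolored points
    contribute 0 on the left. *)
Lemma cond_mean_production :
  \int[P]_w (production lam (@incr K) I Phi cond_mean (counts c w))%:E <=
  \int[P \x mu]_p q p.
Proof.
pose Q (t : S * option K) : \bar R :=
  (if t.2 is Some k then Bregman I Phi (cond_mean t.1) (cond_mean (incr k t.1)) else 0%R)%:E.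
pose M (p : Omega * X) := (counts c p.1, c p.2).
have Bg0 s k : (0 <= Bregman I Phi (cond_mean s) (cond_mean (incr k s)))%R.
  by apply: Bregman_ge0 => //; exact: cond_mean_in.
have Q0 t : 0 <= Q t by rewrite /Q; case: (t.2) => [k|]; rewrite lee_fin.
have mM t : measurable (M @^-1` [set t]).
  case: t => s o; rewrite (_ : _ @^-1` _ = fiber s `*` (c @^-1` [set o])); last first.
    by apply/seteqP; split => -[w x] /=; rewrite /M/fiber/= => -[-> ->].
  apply: measurableX => //; case: o => [k|]; first exact: mc.
  exact: measurable_uncolored cc.
have mQ : measurable_fun setT (Q \o M).
  move=> _ V mV; rewrite setTI comp_preimage.
  exact: measurable_preimage_fibers.
rewrite (eq_integral (fun w => \int[mu]_x (Q \o M) (w, x))); last first.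
  by move=> w _; rewrite /Q /M/= integral_coloring.
rewrite -(fubini_tonelli1 _ mQ (fun p => Q0 (M p))).
apply: (le_integral_fibers mM mQ measurable_Bregman_add (fun p => Q0 (M p)) q_ge0).
move=> [s [k|]]; last first.
  rewrite (eq_integral (cst 0)); last by move=> p; rewrite inE /= => ->.
  by rewrite integral0; exact: integral_ge0.
have -> : M @^-1` [set (s, Some k)] = cell s k.
  by apply/seteqP; split => -[w x] /=; rewrite /M/cell/fiber/color/= => -[-> ->].
have mcell : measurable (cell s k) by exact: measurableX.
rewrite (eq_integral (cst (Q (s, Some k)))); last first.
  by move=> [w x]; rewrite inE /cell/fiber/color/= /M /= => -[-> ->].
rewrite integral_cst//.
have cellE : (P \x mu) (cell s k) = (lam k)%:E * P (fiber s).
  by rewrite -(setTI (fiber s)) -cell_fst// preimage_setT setTI.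
have [W0|W0] := eqVneq ((P \x mu) (cell s k)) 0.
  rewrite [X in _ * X](_ : _ = 0) ?mule0; [exact: integral_ge0|exact: W0].
have Wgt0 : 0 < (P \x mu) (cell s k) by rewrite lt_neqAle eq_sym W0 measure_ge0.
have Woo : (P \x mu) (cell s k) < +oo.
  by rewrite cellE; apply: lte_mul_pinfty => //; rewrite lee_fin intensity_ge0.
have lam0 : (0 < lam k)%R.
  rewrite lt_neqAle intensity_ge0 andbT eq_sym; apply/eqP => l0.
  by move: W0; rewrite cellE l0 mul0e eqxx.
have Ps0 : P (fiber s) != 0.
  by apply/eqP => p0; move: W0; rewrite cellE p0 mule0 eqxx.
have [n sk] : exists n, s k = Some n.
  case sk : (s k) => [n|]; first by exists n.
  move: Ps0; rewrite (law_counts P_poisson cc) (bigD1 k)//= /state_weight sk.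
  by rewrite mul0r eqxx.
have n0 : (0 < n.+1%:R :> R)%R by [].
have madd := @measurable_add_point _ X R.
have cfst C (mC : measurable C) := @cell_fst s k C mC.
have cadd C (mC : measurable C) := @cell_add s k n C sk mC.
(* Since the cell has positive mass, Mecke's formula gives positive mass to the raised fiber, so the
   default value of [cond_mean] is not met there. *)
have Pi0 : P (fiber (incr k s)) != 0.
  apply/eqP => p0; move: W0.
  rewrite (measure_scaled_transfer cadd) [X in _ * X](_ : _ = 0) ?mule0 ?eqxx//; exact: p0.
have -> : Q (s, Some k) = (Bregman I Phi
    (fine (\int[P \x mu]_(p in cell s k) (G p.1)%:E) / fine ((P \x mu) (cell s k)))
    (fine (\int[P \x mu]_(p in cell s k) (G (add_point p.1 p.2))%:E) / fine ((P \x mu) (cell s k))))%:E.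
  rewrite /Q/= /cond_mean (negbTE Ps0) (negbTE Pi0); congr (Bregman _ _ _ _)%:E; apply/esym.
    exact: (mean_scaled_transfer mcell (mfiber s) measurable_fst lam0 cfst mG (iGfiber s)).
  exact: (mean_scaled_transfer mcell (mfiber (incr k s)) madd n0 cadd mG (iGfiber (incr k s))).
apply: Bregman_jensen => //.
  exact: (integrable_scaled_transfer mcell (mfiber s) measurable_fst lam0 cfst mG (iGfiber s)).
exact: (integrable_scaled_transfer mcell (mfiber (incr k s)) madd n0 cadd mG (iGfiber (incr k s))).
Qed.

Lemma cond_mean_entropy :
  \int[P]_w (Bregman I Phi (fine (\int[P]_w (cond_mean (counts c w))%:E))
    (cond_mean (counts c w)))%:E <= \int[P \x mu]_p q p.
Proof.
apply: le_trans _ cond_mean_production.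
apply: counts_entropy => //; first exact: cond_mean_in.
exact: integrable_cond_mean.
Qed.

End conditioning.

(** * Approximation by functions of finitely many counts *)

Section approximation.
Local Open Scope ereal_scope.
Context (R : realType) d (X : measurableType d).
Local Notation Omega := (pointMeasure X R).
Variables (mu : {sigma_finite_measure set X -> \bar R}) (P : probability Omega R).
Implicit Types f g h : Omega -> R.

Definition approximable f := forall e : R, (0 < e)%R ->
  exists (K : finType) (c : X -> option K) (u : {ffun K -> option nat} -> R),
    coloring mu c /\ \int[P]_w `|(f w)%:E - (u (counts c w))%:E| <= e%:E.

Let mdist f g : measurable_fun setT f -> measurable_fun setT g ->
  measurable_fun setT (fun w => `|(f w)%:E - (g w)%:E|).
Proof.
move=> mf mg; apply: measurableT_comp => //.
by apply: emeasurable_funB; exact/measurable_EFinP.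
Qed.

Let mcounts (K : finType) (c : X -> option K) (u : {ffun K -> option nat} -> R) :
  coloring mu c -> measurable_fun setT (fun w : Omega => u (counts c w)).
Proof. by move=> cc; apply/measurable_EFinP; exact: measurable_counts_fun cc u. Qed.

Let dist_triangle f g h : measurable_fun setT f -> measurable_fun setT g ->
  measurable_fun setT h ->
  \int[P]_w `|(f w)%:E - (h w)%:E| <=
  \int[P]_w `|(f w)%:E - (g w)%:E| + \int[P]_w `|(g w)%:E - (h w)%:E|.
Proof.
move=> mf mg mh; rewrite -ge0_integralD//; try exact: mdist.
apply: ge0_le_integral => //; try exact: mdist.
  by apply: emeasurable_funD; exact: mdist.
by move=> w _; rewrite -!EFinB !abse_EFin -EFinD lee_fin ler_distD.
Qed.

Lemma approximable_limit f : measurable_fun setT f ->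
  (forall e : R, (0 < e)%R -> exists g, [/\ measurable_fun setT g,
    approximable g & \int[P]_w `|(f w)%:E - (g w)%:E| <= e%:E]) ->
  approximable f.
Proof.
move=> mf H e e0; have e20 : (0 < e / 2)%R by rewrite divr_gt0.
have [g [mg ag fg]] := H _ e20.
have [K [c [u [cc gu]]]] := ag _ e20.
exists K, c, u; split=> //.
apply: le_trans (dist_triangle mf mg (mcounts u cc)) _.
by rewrite (splitr e) EFinD leeD.
Qed.

Lemma approximableD f g : measurable_fun setT f -> measurable_fun setT g ->
  approximable f -> approximable g -> approximable (fun w => f w + g w)%R.
Proof.
move=> mf mg af ag e e0; have e20 : (0 < e / 2)%R by rewrite divr_gt0.
have [K1 [c1 [u1 [cc1 fu]]]] := af _ e20.
have [K2 [c2 [u2 [cc2 gu]]]] := ag _ e20.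
have [e1 e2] := @coarsen_counts _ X R mu _ _ c1 c2 cc1 cc2.
exists (option K1 * option K2)%type, (joint_coloring c1 c2),
  (fun s => u1 (coarsen R fst s) + u2 (coarsen R snd s))%R.
split; first exact: coloring_joint.
rewrite (splitr e) EFinD; apply: le_trans (leeD fu gu).
have m1 := mdist mf (mcounts u1 cc1); have m2 := mdist mg (mcounts u2 cc2).
rewrite -ge0_integralD//; apply: ge0_le_integral => //.
- apply: mdist; first exact: measurable_funD.
  by under eq_fun do rewrite -e1 -e2; apply: measurable_funD; exact: mcounts.
- exact: emeasurable_funD.
- move=> w _; rewrite -e1 -e2 -!EFinB !abse_EFin -EFinD lee_fin.
  by rewrite opprD addrACA ler_normD.
Qed.

Lemma approximableZ f (a : R) : measurable_fun setT f ->
  approximable f -> approximable (fun w => a * f w)%R.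
Proof.
move=> mf af e e0.
have a0 : (0 < `|a| + 1)%R by rewrite ltr_wpDl.
have [K [c [u [cc fu]]]] := af (e / (`|a| + 1))%R (divr_gt0 e0 a0).
exists K, c, (fun s => a * u s)%R; split=> //.
apply: (@le_trans _ _ (`|a|%:E * \int[P]_w `|(f w)%:E - (u (counts c w))%:E|)).
  rewrite -ge0_integralZl_EFin//; last exact: mdist (mcounts u cc).
  rewrite le_eqVlt; apply/orP; left; apply/eqP; apply: eq_integral => w _.
  by rewrite -!EFinB !abse_EFin -EFinM -normrM mulrBr.
apply: le_trans (lee_wpmul2l _ fu) _; first by rewrite lee_fin.
by rewrite -EFinM lee_fin mulrCA ler_piMr ?ltW// ltr_pdivrMr// mul1r ltrDl.
Qed.

Lemma approximable_cylinder C : cylinders mu C -> approximable \1_C.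
Proof.
move=> [K [c [S [cc ->]]]] e e0; exists K, c, \1_S; split=> //.
rewrite (eq_integral (cst 0)) ?integral0 ?lee_fin ?ltW// => w _.
have -> : \1_(counts c @^-1` S) w = \1_S (counts c w) :> R.
  by rewrite !indicE; congr (_%:R); apply/idP/idP; rewrite !inE.
by rewrite subee ?abse0.
Qed.

Lemma approximable_bigsetU (F : (set Omega)^nat) n :
  (forall i, measurable (F i)) -> trivIset setT F ->
  (forall i, approximable \1_(F i)) ->
  approximable \1_(\big[setU/set0]_(i < n) F i).
Proof.
move=> mF tF aF; elim: n => [|n ih].
  rewrite big_ord0 => e e0; exists void, (fun=> None), (fun=> 0%R); split; first by case.
  rewrite (eq_integral (cst 0)) ?integral0 ?lee_fin ?ltW// => w _.
  by rewrite indicE in_set0 subee ?abse0.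
rewrite big_ord_recr/=.
have -> : \1_(\big[setU/set0]_(i < n) F i `|` F n) =
    (fun w => \1_(\big[setU/set0]_(i < n) F i) w + \1_(F n) w)%R :> (Omega -> R).
  apply/funext => w; rewrite !indicE in_setU.
  have [wn|wn] := boolP (w \in F n); last by rewrite orbF addr0.
  rewrite orbT; case: (boolP (w \in _)) => [|_]; last by rewrite add0r.
  rewrite inE -bigcup_mkord => -[i /= ilt Fi]; exfalso.
  move/trivIsetP : tF => /(_ i n I I); rewrite (ltn_eqF ilt) => /(_ isT).
  by move/seteqP => [/(_ w) + _]; apply; split=> //; exact: set_mem.
apply: approximableD => //.
- apply: measurable_indic; exact: bigsetU_measurable.
Qed.

(** A Dynkin argument over cylinders: complements follow by linearity, and a countable disjoint
    union is the [L1] limit of its finite unions because [P] is finite. *)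
Lemma approximable_indic C : measurable C -> approximable \1_C.
Proof.
move=> mC; have gen := measurable_cylinders (sigma_finiteT mu).
have a1 : approximable \1_setT by exact: approximable_cylinder (cylindersT mu).
apply: (@dynkin_induction _ Omega (cylinders mu) (fun C => approximable \1_C) gen
  (@setI_closed_cylinders _ X R mu) a1).
- by move=> C' /approximable_cylinder.
- move=> C' mC' aC'.
  have -> : \1_(~` C') = (fun w => \1_setT w + (-1) * \1_C' w)%R :> (Omega -> R).
    by apply/funext => w; rewrite !indicE in_setT in_setC; case: (w \in C'); rewrite /= ?mulr1 ?mulr0 ?subrr ?addr0.
  apply: approximableD => //.
    by apply: measurable_funM => //; exact: measurable_indic.
  by apply: approximableZ => //; exact: measurable_indic.
- move=> F mF tF aF; have mU : measurable (\bigcup_k F k) by exact: bigcup_measurable.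
  apply: approximable_limit; first exact: measurable_indic.
  move=> e e0; pose A n := \big[setU/set0]_(i < n) F i.
  have mA n : measurable (A n) by exact: bigsetU_measurable.
  have AU n : A n `<=` \bigcup_k F k by rewrite /A -bigcup_mkord => w [i _ Fi]; exists i.
  have cvgA : (fun n => P (A n)) @ \oo --> P (\bigcup_k F k).
    rewrite (_ : (fun n => _) = (fun n => \sum_(0 <= i < n) P (F i))).
      exact: measure_semi_sigma_additive.
    by apply/funext => n; rewrite /A big_mkord (@measure_bigsetU _ _ _ P).
  have PE B : measurable B -> P B = (fine (P B))%:E.
    by move=> mB; rewrite fineK// fin_num_measure.
  have {}cvgA : (fun n => fine (P (A n))) @ \oo --> fine (P (\bigcup_k F k)).
    by apply: fine_cvg; rewrite -PE.
  have /cvgrPdist_le/(_ _ e0)[n _ /(_ n (leqnn _)) An] := cvgA.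
  exists \1_(A n); split; [exact: measurable_indic|exact: approximable_bigsetU|].
  rewrite (eq_integral (fun w => (\1_(\bigcup_k F k `\` A n) w)%:E)); last first.
    move=> w _; rewrite !indicE in_setD.
    have [wA|wA] := boolP (w \in A n); last first.
      by rewrite andbT sube0 gee0_abs// lee_fin.
    rewrite (_ : (w \in \bigcup_k F k) = true); last exact/mem_set/(AU n)/set_mem.
    by rewrite andbF subee// abse0.
  rewrite integral_indic//; last exact: measurableD.
  have PD : P (\bigcup_k F k `\` A n) =
      (fine (P (\bigcup_k F k)) - fine (P (A n)))%:E.
    rewrite EFinB -!PE// -[in RHS](setIidr (AU n)); apply: measureD => //.
    by rewrite ltey_eq fin_num_measure.
  rewrite setIT [leLHS]PD lee_fin.
  exact: le_trans (ler_norm _) An.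
- by rewrite -gen.
Qed.

Import HBSimple.

Lemma approximable_integrable f : P.-integrable setT (EFin \o f) ->
  approximable f.
Proof.
move=> intf; have mf : measurable_fun setT f.
  by apply/measurable_EFinP; exact: measurable_int intf.
apply: approximable_limit => // e e0.
have [g_ [_ _ gf]] := approximation_sfun_integrable measurableT intf.
have : \forall n \near \oo, \int[P]_w `|(f w)%:E - (g_ n w)%:E| <= e%:E.
  have /fine_cvgP[fin /cvgrPdist_le/(_ _ e0) le] := gf.
  near=> n; have fn : \int[P]_w `|(f w)%:E - (g_ n w)%:E| \is a fin_num.
    by near: n; exact: fin.
  rewrite -(fineK fn) lee_fin.
  have : (`|0 - fine (\int[P]_w `|(f w)%:E - (g_ n w)%:E|)| <= e)%R.
    by near: n; exact: le.
  by rewrite sub0r normrN; apply: le_trans; exact: ler_norm.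
move=> [n _ /(_ n (leqnn _)) gn]; exists (g_ n); split=> //.
have -> : (g_ n : Omega -> R) = (fun w =>
   \sum_(y <- finmap.enum_fset (fset_set (range (g_ n)))) (y * \1_(g_ n @^-1` [set y]) w))%R.
  by apply/funext => w; rewrite [LHS]fimfunE fsbig_finite.
elim: (finmap.enum_fset _) => [|y s ih].
  under eq_fun do rewrite big_nil.
  move=> r r0; exists void, (fun=> None), (fun=> 0%R); split; first by case.
  rewrite (eq_integral (cst 0)) ?integral0 ?lee_fin ?ltW// => w _.
  by rewrite subee ?abse0.
under eq_fun do rewrite big_cons.
have mi (z : R) : measurable (g_ n @^-1` [set z]) by exact: measurable_funPTI.
apply: approximableD => //.
- by apply: measurable_funM => //; exact: measurable_indic.
- apply: measurable_sum => z; apply: measurable_funM => //; exact: measurable_indic.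
- by apply: approximableZ; [exact: measurable_indic|exact: approximable_indic].
Unshelve. all: by end_near. Qed.

End approximation.

(** * From [L1] to almost sure convergence *)

Section L1_subsequence.
Local Open Scope ereal_scope.
Context d (T : measurableType d) (R : realType) (P : probability T R).

(** The geometric rate makes the sum of all errors integrable, hence finite almost everywhere, so
    the errors tend to 0 along the whole sequence. *)
Lemma cvg_ae_of_summable (f : T -> R) (g : nat -> T -> R) :
  measurable_fun setT f -> (forall n, measurable_fun setT (g n)) ->
  (forall n, \int[P]_w `|(f w)%:E - (g n w)%:E| <= (2^-1 ^+ n)%:E) ->
  exists N : set T, [/\ measurable N, P N = 0 &
    forall w, (~` N) w -> (fun n => g n w) @ \oo --> f w].
Proof.
move=> mf mg fg; pose h n w : \bar R := `|(f w)%:E - (g n w)%:E|.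
have mh n : measurable_fun setT (h n).
  by apply: measurableT_comp => //; apply: emeasurable_funB; exact/measurable_EFinP.
have h0 n w : 0 <= h n w by exact: abse_ge0.
have mH : measurable_fun setT (fun w => \sum_(n <oo) h n w).
  exact: ge0_emeasurable_sum.
have H0 w : 0 <= \sum_(n <oo) h n w by exact: nneseries_ge0.
have iH : P.-integrable setT (fun w => \sum_(n <oo) h n w).
  apply/integrableP; split => //.
  rewrite (eq_integral (fun w => \sum_(n <oo) h n w)); last first.
    by move=> w _; rewrite gee0_abs.
  rewrite integral_nneseries//.
  apply: (@le_lt_trans _ _ (\sum_(n <oo) (2^-1 ^+ n)%:E)).
    by apply: lee_nneseries => [n _ _|n _]; [exact: integral_ge0|exact: fg].
  have : series (geometric 1 2^-1) @ \oo --> (1 * (1 - 2^-1)^-1 : R)%R.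
    by apply: cvg_geometric_series; rewrite ger0_norm// invf_lt1// ltr1n.
  move=> gs; rewrite (_ : \sum_(n <oo) _ = (1 * (1 - 2^-1)^-1)%:E) ?ltry//.
  apply/cvg_lim => //.
  rewrite (_ : (fun n => _) = EFin \o series (geometric 1 2^-1)); last first.
    by apply/funext => n; rewrite /= -sumEFin; apply: eq_bigr => i _; rewrite /= mul1r.
  exact: cvg_comp gs _.
have [N [mN N0 HN]] := integrable_ae measurableT iH.
exists N; split=> // w Nw.
have Hfin : \sum_(n <oo) h n w \is a fin_num.
  by apply: contrapT => nfin; apply: Nw; apply: HN => /= /(_ I).
have hE n : h n w = `|f w - g n w|%:E by [].
have hcvg : (fun n => `|f w - g n w|)%R @ \oo --> (0 : R)%R.
  apply: cvg_series_cvg_0.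
  have : (fun n => \sum_(0 <= k < n) h k w) @ \oo --> (fine (\sum_(n <oo) h n w))%:E.
    by rewrite fineK//; apply: is_cvg_nneseries.
  move/fine_cvg => H; apply/cvg_ex; exists (fine (\sum_(n <oo) h n w)).
  apply: cvg_trans H; apply: near_eq_cvg; apply: nearW => n /=.
  by rewrite /series/= sumEFin.
apply/cvgrPdist_le => e e0; have /cvgrPdist_le/(_ _ e0) := hcvg.
by apply: filterS => n; rewrite sub0r normrN normr_id.
Qed.

End L1_subsequence.

(** * Passage to the limit *)

Section entropy_inequality.
Local Open Scope ereal_scope.
Context (R : realType) (I : set R) (Phi : R -> R).
Hypothesis Iitv : is_interval I.
Hypothesis Iclosed : closed I.
Hypothesis Phi_smooth : smooth_in I Phi.
Hypothesis Psi_ge0 : forall u v, I u -> I (u + v)%R -> (0 <= Psi I Phi u v)%R.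
Hypothesis Psi_convex : convex_function (Psi_domain I)
                  (fun p => Psi I Phi p.1 p.2).
Context d (X : measurableType d).
Local Notation Omega := (pointMeasure X R).
Variables (mu : {sigma_finite_measure set X -> \bar R}) (P : probability Omega R).
Hypothesis P_poisson : is_poisson_law mu P.
Variable G : Omega -> R.
Hypotheses (mG : measurable_fun setT G) (iG : P.-integrable setT (EFin \o G)).
Hypothesis G_in : forall w, I (G w).

Let rhs := \int[P \x mu]_p (Bregman I Phi (G p.1) (G (add_point p.1 p.2)))%:E.

Let mean (g : Omega -> R) := fine (\int[P]_w (g w)%:E).

Lemma cylinder_approximation n : exists g : Omega -> R,
  [/\ measurable_fun setT g, P.-integrable setT (EFin \o g), forall w, I (g w),
    \int[P]_w `|(G w)%:E - (g w)%:E| <= (2^-1 ^+ n)%:E &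
    \int[P]_w (Bregman I Phi (mean g) (g w))%:E <= rhs].
Proof.
(* Exponent [n.+1] because replacing [u] by the conditional mean may double the error. *)
have e0 : (0 < 2^-1 ^+ n.+1 :> R)%R by rewrite exprn_gt0// invr_gt0.
have [K [c [u [cc Gu]]]] := approximable_integrable mu iG e0.
exists (fun w => cond_mean P G c (counts c w)); split.
- by apply/measurable_EFinP; exact: (measurable_counts_fun cc).
- exact: integrable_cond_mean.
- by move=> w; exact: (cond_mean_in Iitv iG G_in cc).
- apply: le_trans (cond_mean_dist2 mG iG cc u) _.
  apply: le_trans (lee_wpmul2l _ Gu) _; first by rewrite lee_fin.
  by rewrite -EFinM lee_fin exprS mulrA mulfV ?mul1r.
- exact: cond_mean_entropy.
Qed.

Lemma mean_G_in : I (mean G).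
Proof. exact: (mean_in_probability Iitv iG). Qed.

(** The base point [mean (g n)] moves with [n], so the pointwise limit uses continuity of [Phi'] as
    well as of [Phi]. Fatou's lemma is applied off the null set where [g n] may fail to converge. *)
Lemma Bregman_entropy :
  \int[P]_w (Bregman I Phi (mean G) (G w))%:E <= rhs.
Proof.
have [g gP] := choice cylinder_approximation.
have mg n : measurable_fun setT (g n) by have [] := gP n.
have ig n : P.-integrable setT (EFin \o g n) by have [] := gP n.
have Ig n w : I (g n w) by have [_ _ h _ _] := gP n; exact: h.
have dg n : \int[P]_w `|(G w)%:E - (g n w)%:E| <= (2^-1 ^+ n)%:E by have [] := gP n.
have eg n : \int[P]_w (Bregman I Phi (mean (g n)) (g n w))%:E <= rhs by have [] := gP n.
have Img n : I (mean (g n)) by exact: (mean_in_probability Iitv (ig n)).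
have meanG := mean_G_in.
have [N [mN N0 cvgN]] := cvg_ae_of_summable mG mg dg.
have cvgm : (fun n => mean (g n)) @ \oo --> mean G.
  apply/cvgrPdist_le => e e0.
  have : (fun n => 2^-1 ^+ n : R)%R @ \oo --> (0 : R)%R.
    by apply: cvg_expr; rewrite ger0_norm// invf_lt1// ltr1n.
  move/cvgrPdist_le/(_ _ e0); apply: filterS => n.
  rewrite sub0r normrN ger0_norm ?exprn_ge0//; apply: le_trans.
  rewrite -lee_fin; apply: le_trans (dg n).
  have -> : (`|mean G - mean (g n)|)%:E = `|\int[P]_w ((G w)%:E - (g n w)%:E)|.
    have GE : \int[P]_w (G w)%:E = (mean G)%:E.
      by rewrite fineK//; exact: integrable_fin_num.
    have gE : \int[P]_w (g n w)%:E = (mean (g n))%:E.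
      by rewrite fineK//; exact: (integrable_fin_num measurableT (ig n)).
    by rewrite (integralB_EFin measurableT iG (ig n)) GE gE.
  apply: le_abse_integral => //.
  by apply: emeasurable_funB; exact/measurable_EFinP.
have B0 x y : I x -> I y -> (0 <= Bregman I Phi x y)%R by exact: Bregman_ge0.
pose F n w := (Bregman I Phi (mean (g n)) (g n w))%:E.
have mF n : measurable_fun setT (F n).
  by apply/measurable_EFinP; apply: measurable_Bregman => //; exact: measurable_cst.
have mC : measurable (~` N) by exact: measurableC.
rewrite (@ge0_negligible_integral _ _ _ _ setT N)//; last 2 first.
- by apply/measurable_EFinP; apply: measurable_Bregman => //; exact: measurable_cst.
- by move=> w _; rewrite lee_fin B0.
rewrite setTD (eq_integral (fun w => limn_einf (F ^~ w))); last first.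
  move=> w /[!inE] Nw.
  suff cF : F ^~ w @ \oo --> (Bregman I Phi (mean G) (G w))%:E.
    by apply/esym; exact: (cvg_limn_einf_sup cF).1.
  have lim : (fun n => Phi (g n w) - Phi (mean (g n)) - derive_in I Phi (mean (g n)) * (g n w - mean (g n)))%R
     @ \oo --> (Phi (G w) - Phi (mean G) - derive_in I Phi (mean G) * (G w - mean G))%R.
    have cPhi := continuous_Phi Phi_smooth; have cdPhi := continuous_dPhi Phi_smooth.
    apply: cvgB.
      apply: cvgB; first exact: (cvg_comp_within cPhi (G_in w) (Ig ^~ w) (cvgN w Nw)).
      exact: (cvg_comp_within cPhi meanG Img cvgm).
    apply: cvgM; first exact: (cvg_comp_within cdPhi meanG Img cvgm).
    by apply: cvgB => //; exact: cvgN.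
  rewrite (_ : F ^~ w = EFin \o (fun n => Phi (g n w) - Phi (mean (g n)) - derive_in I Phi (mean (g n)) * (g n w - mean (g n)))%R); last first.
    by apply/funext => n; rewrite /F/= BregmanE.
  by rewrite BregmanE; exact: cvg_comp lim _.
apply: le_trans (fatou P mC _ _) _.
- by move=> n; exact: measurable_funTS.
- by move=> n w _; rewrite lee_fin B0.
rewrite limn_einf_lim; apply: lime_le; first exact: is_cvg_einfs.
apply: nearW => n; apply: le_trans (eg n).
apply: (@le_trans _ _ (\int[P]_(w in ~` N) F n w)).
  by apply: ereal_inf_lbound; exists n => /=.
by apply: ge0_subset_integral => // w _; rewrite lee_fin B0.
Qed.

(** When [rhs] is finite, [Bregman_entropy] makes the divergence integrable, so [Phi o G] is an
    integrable sum of it and an affine function of [G]; the latter has mean [Phi (mean G)]. *)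
Lemma Phi_entropy : Ent Phi P G <= rhs.
Proof.
have meanG := mean_G_in; have iGE := integrable_fin_num measurableT iG.
have B0 w : (0 <= Bregman I Phi (mean G) (G w))%R by exact: Bregman_ge0.
have [->|rfin] := eqVneq rhs +oo; first by rewrite leey.
have le_rhs := Bregman_entropy.
have mB : measurable_fun setT (fun w => (Bregman I Phi (mean G) (G w))%:E).
  by apply/measurable_EFinP; apply: measurable_Bregman => //; exact: measurable_cst.
have iB : P.-integrable setT (fun w => (Bregman I Phi (mean G) (G w))%:E).
  apply/integrableP; split => //.
  rewrite (eq_integral (fun w => (Bregman I Phi (mean G) (G w))%:E)); last first.
    by move=> w _; rewrite gee0_abs// lee_fin.
  by apply: le_lt_trans le_rhs _; rewrite ltey.
apply: le_trans le_rhs; rewrite /Ent unlock.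
rewrite -[fine _]/(mean G).
pose a := derive_in I Phi (mean G).
have ic (r : R) : P.-integrable setT (cst r%:E) by exact: finite_measure_integrable_cst.
have ia : P.-integrable setT (fun w => a%:E * (G w)%:E) by exact: integrableZl.
have PhiE w : (Phi (G w))%:E = (Bregman I Phi (mean G) (G w))%:E +
    ((Phi (mean G) - a * mean G)%:E + a%:E * (G w)%:E).
  by rewrite -EFinM -!EFinD BregmanE; congr EFin; rewrite /a; ring.
under eq_integral do rewrite PhiE.
have iac := integrableD measurableT (ic (Phi (mean G) - a * mean G)%R) ia.
rewrite (integralD measurableT iB iac) (integralD measurableT (ic _) ia) integralZl//.
rewrite (integral_cst P measurableT)/= probability_setT mule1.
rewrite -[X in a%:E * X]fineK// -[fine _]/(mean G).
by rewrite -EFinM -EFinD subrK addeK.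
Qed.

End entropy_inequality.

(* [sigma_finite_measure] is not inferred for a product of a probability with a
   sigma-finite measure, hence the explicit packing in the main proof. *)
Lemma sigma_finite_leb01_product (R : realType) d (E : measurableType d)
    (nu : {sigma_finite_measure set E -> \bar R}) :
  sigma_finite setT (leb01 \x nu)%E.
Proof.
have [F FT mF] := sigma_finiteT nu; exists (fun n => setT `*` F n).
  apply/seteqP; split => // -[t z] _.
  have [n _ Fz] : (\bigcup_n F n) z by rewrite -FT.
  by exists n.
move=> n; have [mFn Fn] := mF n; split; first exact: measurableX.
rewrite product_measure1E// [X in (X * _)%E](_ : _ = 1%E) ?mul1e//.
exact: (@probability_setT _ _ _ (leb01 : probability (unitI R) R)).
Qed.

Theorem mainTheorem16 (R : realType)
  (I : set R) (Iitv : is_interval I) (Iclosed : closed I)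
  (Phi : R -> R) (Phi_smooth : smooth_in I Phi)
  (Phi_convex : convex_function (I : set R^o) Phi)
  (Psi_ge0 : forall u v, I u -> I (u + v) -> 0 <= Psi I Phi u v)
  (Psi_convex : convex_function (Psi_domain I)
                  (fun p => Psi I Phi p.1 p.2))
  (d : measure_display) (E : measurableType d)
  (nu : {sigma_finite_measure set E -> \bar R})
  (P : probability (pointMeasure (unitI R * E)%type R) R)
  (P_poisson : is_poisson_law (leb01 \x nu)%E P)
  (G : pointMeasure (unitI R * E)%type R -> R)
  (G_L2 : G \in Lfun P 2%:E)
  (G_in_I : forall w, I (G w))
  (G_gt_inf : forall w, (ereal_inf (EFin @` I) < (G w)%:E)%E) :
  (Ent Phi P G <=
   \int[P]_w \int[leb01]_t \int[nu]_z
     (Psi I Phi (G w) (D_ (t, z) G w))%:E)%E.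
Proof.
have G_L1 : G \in Lfun P 1.
  by apply: Lfun_subset12 G_L2; exact: fin_num_measure.
have iG : P.-integrable setT (EFin \o G) by exact/Lfun1_integrable.
have mG : measurable_fun setT G by apply/measurable_EFinP; exact: measurable_int iG.
have mq := measurable_Bregman_add Iclosed Phi_smooth mG G_in_I.
have q0 p : (0 <= (Bregman I Phi (G p.1) (G (add_point p.1 p.2)))%:E)%E.
  by rewrite lee_fin; exact: Bregman_ge0.
pose sf := Measure_isSigmaFinite.Build _ _ _ _ (sigma_finite_leb01_product nu).
pose mu : {sigma_finite_measure set (unitI R * E)%type -> \bar R} :=
  HB.pack (leb01 \x nu)%E sf.
have H := Phi_entropy Iitv Iclosed Phi_smooth Psi_ge0 Psi_convex
  (P_poisson : is_poisson_law mu P) mG iG G_in_I.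
apply: (le_trans H).
(* Tonelli is applied twice: to separate [P] from [leb01 \x nu], then to separate [t] from [z]. The
   integrands agree by the definitions of [Bregman] and [D_]. *)
rewrite (fubini_tonelli1 _ mq q0) le_eqVlt; apply/orP; left; apply/eqP.
apply: eq_integral => w _; rewrite /fubini_F.
rewrite (fubini_tonelli1 (fun tz => (Bregman I Phi (G w) (G (add_point w tz)))%:E))//.
exact: (measurable_fun_pair2 w mq).
by move=> tz; exact: (q0 (w, tz)).
Qed.
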